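(* Suppose the weighted composition operators $C_{\phi_1,\omega_1}$ and $C_{\phi_2,\omega_2}$ in $L^2(\mu)$ are densely defined. Let $\mathbf{C}_{\phi,\omega}=\binom{U_1}{U_2}|\mathbf{C}_{\phi,\omega}|$ be the polar decomposition of the pair $\mathbf{C}_{\phi,\omega}=(C_{\phi_1,\omega_1},C_{\phi_2,\omega_2})$. Then for $i=1,2$: (i) $|\mathbf{C}_{\phi,\omega}|=M_{\sqrt{h_{\phi_1,\omega_1}+h_{\phi_2,\omega_2}}}$. In particular, $|C_{\phi_i,\omega_i}|=\left|\binom{C_{\phi_i,\omega_i}}{0}\right|=M_{\sqrt{h_{\phi_i,\omega_i}}}$; (ii) $U_i=C_{\phi_i,\widetilde{\omega_i}}$, where $\widetilde{\omega_i}$ is the complex $\mathscr{A}$-measurable function given by $$\widetilde{\omega_i}=\frac{\omega_i\cdot\chi_{\{\omega_i\neq0\}}}{\sqrt{(h_{\phi_1,\omega_1}+h_{\phi_2,\omega_2})\circ\phi_i}}\quad\text{a.e. }[\mu],$$ and $$\|U_i\|=\left\|\frac{h_{\phi_i,\omega_i}}{h_{\phi_1,\omega_1}+h_{\phi_2,\omega_2}}\cdot\chi_{\{h_{\phi_1,\omega_1}+h_{\phi_2,\omega_2}>0\}}\right\|_\infty^{1/2}.$$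
   Context: $(X,\mathscr{A},\mu)$ is a $\sigma$-finite measure space and $L^2(\mu)$ is the complex Hilbert space. For an $\mathscr{A}$-measurable transformation $\phi:X\to X$ and an $\mathscr{A}$-measurable $\omega:X\to\mathbb{C}$, put $\mu_\omega(\Delta)=\int_\Delta|\omega|^2d\mu$. The weighted composition operator $C_{\phi,\omega}$ in $L^2(\mu)$ has domain $\mathcal{D}(C_{\phi,\omega})=\{f\in L^2(\mu):\omega\cdot(f\circ\phi)\in L^2(\mu)\}$ and acts by $C_{\phi,\omega}f=\omega\cdot(f\circ\phi)$. It is always assumed that $\mu_\omega\circ\phi^{-1}\ll\mu$ (so $C_{\phi,\omega}$ is well-defined). $h_{\phi,\omega}:X\to[0,\infty]$ is the ($\mu$-a.e. unique) measurable function with $\mu_\omega(\phi^{-1}(\Delta))=\int_\Delta h_{\phi,\omega}\,d\mu$ for all $\Delta\in\mathscr{A}$. A pair $\mathbf{C}_{\phi,\omega}=(C_{\phi_1,\omega_1},C_{\phi_2,\omega_2})$ is identified with the column operator $f\mapsto\binom{C_{\phi_1,\omega_1}f}{C_{\phi_2,\omega_2}f}$ from $L^2(\mu)$ into $L^2(\mu)\oplus L^2(\mu)$ with domain $\mathcal{D}(C_{\phi_1,\omega_1})\cap\mathcal{D}(C_{\phi_2,\omega_2})$. When both components are densely defined this operator is densely defined and closed; its polar decomposition is $\mathbf{C}_{\phi,\omega}=U|\mathbf{C}_{\phi,\omega}|$ with $|\mathbf{C}_{\phi,\omega}|=(\mathbf{C}_{\phi,\omega}^*\mathbf{C}_{\phi,\omega})^{1/2}$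 and $U=\binom{U_1}{U_2}$ the partial isometry with $\mathcal{N}(U)=\mathcal{N}(\mathbf{C}_{\phi,\omega})$. For an operator $T$, $|T|=(T^*T)^{1/2}$. $M_g$ denotes the multiplication operator by $g$ in $L^2(\mu)$ with domain $\{f\in L^2(\mu):gf\in L^2(\mu)\}$. The function $\widetilde{\omega_i}$ is understood as $0$ where $\omega_i=0$; the formula makes sense since $\mu(\{\omega_i\neq0\}\cap\{(h_{\phi_1,\omega_1}+h_{\phi_2,\omega_2})\circ\phi_i=0\})=0$. $\|\cdot\|_\infty$ is the essential supremum with respect to $\mu$. *)

(* Defs.v *)
From HB Require Import structures.
From mathcomp Require Import all_boot all_order all_algebra.
From mathcomp Require Import sesquilinear ring_quotient generic_quotient complex.
From mathcomp Require Import all_classical all_reals all_analysis.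
From mathcomp Require Import measurable_realfun ess_sup_inf lebesgue_Rintegral.
From mathcomp Require Import ring lra.

Set Implicit Arguments.
Unset Strict Implicit.
Unset Printing Implicit Defensive.

Import Order.TTheory GRing.Theory Num.Theory.
Import numFieldNormedType.Exports.

Local Open Scope classical_set_scope.
Local Open Scope complex_scope.
Local Open Scope ring_scope.

Section complex_functions.
Context d (X : measurableType d) (R : realType).
Implicit Types f g : X -> R[i].

Definition cmeasurable f :=
  measurable_fun setT (fun x => complex.Re (f x)) /\
  measurable_fun setT (fun x => complex.Im (f x)).

Definition sqmod (z : R[i]) : R := complex.Re z ^+ 2 + complex.Im z ^+ 2.

Lemma sqmodE z : (sqmod z)%:C = `|z| ^+ 2.
Proof. exact: add_Re2_Im2. Qed.

Lemma sqmod_ge0 z : 0 <= sqmod z.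
Proof. by rewrite addr_ge0// sqr_ge0. Qed.

Lemma sqmod_eq0 z : (sqmod z == 0) = (z == 0).
Proof.
have -> : (z == 0) = (`|z| ^+ 2 == 0) by rewrite expf_eq0 normr_eq0.
by rewrite -sqmodE eq_complex /= eqxx andbT.
Qed.

Lemma sqmodM z w : sqmod (z * w) = sqmod z * sqmod w.
Proof. by case: z w => [a b] [c e]; rewrite /sqmod /=; ring. Qed.

Lemma sqmodD_le z w : sqmod (z + w) <= 2 * sqmod z + 2 * sqmod w.
Proof.
case: z w => [a b] [c e]; rewrite /sqmod /=.
have := sqr_ge0 (a - c); have := sqr_ge0 (b - e); nra.
Qed.

Lemma measurable_sqmod f : cmeasurable f ->
  measurable_fun setT (fun x => (sqmod (f x))%:E).
Proof.
move=> [mr mi]; apply/measurable_EFinP; apply: measurable_funD;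
  exact: measurable_funX.
Qed.

Lemma cmeasurableD f g : cmeasurable f -> cmeasurable g ->
  cmeasurable (fun x => f x + g x).
Proof.
move=> [fr fi] [gr gi]; split.
- rewrite (_ : (fun _ => _) = (fun x => complex.Re (f x) + complex.Re (g x))).
    exact: measurable_funD.
  by apply/funext => x; case: (f x) (g x) => [? ?] [? ?].
- rewrite (_ : (fun _ => _) = (fun x => complex.Im (f x) + complex.Im (g x))).
    exact: measurable_funD.
  by apply/funext => x; case: (f x) (g x) => [? ?] [? ?].
Qed.

Lemma cmeasurable_cst (c : R[i]) : cmeasurable (fun _ : X => c).
Proof. by split; exact: measurable_cst. Qed.

Lemma cmeasurableM f g : cmeasurable f -> cmeasurable g ->
  cmeasurable (fun x => f x * g x).
Proof.
move=> [fr fi] [gr gi]; split.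
- rewrite (_ : (fun _ => _) =
    (fun x => complex.Re (f x) * complex.Re (g x) - complex.Im (f x) * complex.Im (g x))).
    by apply: measurable_funB; exact: measurable_funM.
  by apply/funext => x; case: (f x) (g x) => [? ?] [? ?].
- rewrite (_ : (fun _ => _) =
    (fun x => complex.Re (f x) * complex.Im (g x) + complex.Im (f x) * complex.Re (g x))).
    by apply: measurable_funD; exact: measurable_funM.
  by apply/funext => x; case: (f x) (g x) => [? ?] [? ?].
Qed.

Lemma cmeasurable_conj f : cmeasurable f -> cmeasurable (fun x => conjc (f x)).
Proof.
move=> [fr fi]; split.
- by rewrite (_ : (fun _ => _) = (fun x => complex.Re (f x)))//;
    apply/funext => x; case: (f x).
- rewrite (_ : (fun _ => _) = (fun x => - complex.Im (f x))); last first.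
    by apply/funext => x; case: (f x).
  exact: measurableT_comp.
Qed.

End complex_functions.

Section L2_functions.
Context d (X : measurableType d) (R : realType).
Variable mu : {measure set X -> \bar R}.
Implicit Types f g : X -> R[i].

Definition square_integrable f :=
  cmeasurable f /\ (\int[mu]_x (sqmod (f x))%:E < +oo)%E.

Definition sqint : {pred X -> R[i]} := fun f => `[< square_integrable f >].

Lemma sqintP f : reflect (square_integrable f) (f \in sqint).
Proof. exact: asboolP. Qed.

Lemma sqint_submod_closed : submod_closed sqint.
Proof.
split.
  apply/sqintP; split; first exact: cmeasurable_cst.
  rewrite (eq_integral (cst 0%E)); first by rewrite integral0 ltry.
  by move=> x _; rewrite /sqmod /= expr0n /= addr0.
move=> a f g /sqintP[mf f2] /sqintP[mg g2]; apply/sqintP.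
have maf : cmeasurable (fun x => a * f x).
  by apply: cmeasurableM => //; exact: cmeasurable_cst.
have mafg : cmeasurable (a *: f + g) by apply: cmeasurableD.
split => //.
have sq0 (h : X -> R[i]) x : (0 <= (sqmod (h x))%:E)%E.
  by rewrite lee_fin sqmod_ge0.
apply: (@le_lt_trans _ _ (\int[mu]_x ((2 * sqmod a)%:E * (sqmod (f x))%:E
    + 2%:E * (sqmod (g x))%:E)%E)%E).
  apply: ge0_le_integral => //.
  - exact: measurable_sqmod.
  - by apply: emeasurable_funD; apply: measurable_funeM; exact: measurable_sqmod.
  - move=> x _; rewrite -!EFinM -EFinD lee_fin.
    by rewrite (le_trans (sqmodD_le _ _))// sqmodM mulrA.
rewrite ge0_integralD//; last 4 first.
- by move=> x _; rewrite mule_ge0// ?sq0// lee_fin mulr_ge0// sqmod_ge0.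
- by apply: measurable_funeM; exact: measurable_sqmod.
- by move=> x _; rewrite mule_ge0// ?sq0// lee_fin.
- by apply: measurable_funeM; exact: measurable_sqmod.
rewrite !ge0_integralZl_EFin//; try exact: measurable_sqmod;
  rewrite ?mulr_ge0// ?sqmod_ge0//.
by rewrite lte_add_pinfty// lte_mul_pinfty// lee_fin mulr_ge0// sqmod_ge0.
Qed.

HB.instance Definition _ :=
  GRing.isSubmodClosed.Build R[i] (X -> R[i]) sqint sqint_submod_closed.

Record L2fun := MkL2fun { L2fun_val :> X -> R[i]; _ : L2fun_val \in sqint }.

HB.instance Definition _ := [isSub for L2fun_val].
HB.instance Definition _ := [Choice of L2fun by <:].
HB.instance Definition _ := [SubChoice_isSubLmodule of L2fun by <:].

Definition ae_null : {pred L2fun} :=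
  fun f : L2fun => `[< \forall x \ae mu, f x = 0 >].

Lemma ae_null_submod_closed : submod_closed ae_null.
Proof.
split; first by apply/asboolP; exact/aeW.
move=> a f g /asboolP f0 /asboolP g0; apply/asboolP.
apply: filterS2 f0 g0 => x f0 g0.
by rewrite -[LHS]/(a * f x + g x) f0 g0 mulr0 addr0.
Qed.

HB.instance Definition _ :=
  GRing.isSubmodClosed.Build R[i] L2fun ae_null ae_null_submod_closed.

Definition L2 := Quotient.quot ae_null.
HB.instance Definition _ := GRing.Zmodule.on L2.
HB.instance Definition _ := EqQuotient.on L2.

Definition L2class (f : L2fun) : L2 := \pi_L2%qT f.
Definition L2rep (F : L2) : L2fun := repr F.
Definition L2fct (F : L2) : X -> R[i] := L2fun_val (L2rep F).
Coercion L2fct : L2 >-> Funclass.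

Lemma L2repK : cancel L2rep L2class. Proof. exact: reprK. Qed.

Lemma L2classD : {morph L2class : f g / f + g}.
Proof. exact: Quotient.pi_add. Qed.

Lemma L2class0 : L2class 0 = 0.
Proof. by apply: (addrI (L2class 0)); rewrite -L2classD !addr0. Qed.

Lemma eq_L2class (f g : L2fun) :
  L2class f = L2class g <-> \forall x \ae mu, f x = g x.
Proof.
split=> [/eqP|fg].
  rewrite -Quotient.idealrBE => /asboolP; apply: filterS => x /eqP.
  by rewrite -[X in X == _]/(f x - g x) subr_eq0 => /eqP.
apply/eqP; rewrite -Quotient.idealrBE; apply/asboolP.
by apply: filterS fg => x fg; rewrite -[LHS]/(f x - g x) fg subrr.
Qed.

Lemma L2classK (f : L2fun) : \forall x \ae mu, L2class f x = f x.
Proof. by apply/eq_L2class; rewrite L2repK. Qed.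

Lemma L2P (F G : L2) : F = G <-> \forall x \ae mu, F x = G x.
Proof. by rewrite -eq_L2class !L2repK. Qed.

Definition L2scale (a : R[i]) (F : L2) : L2 := L2class (a *: L2rep F).

Lemma L2classZ a (f : L2fun) : L2class (a *: f) = L2scale a (L2class f).
Proof.
apply/eq_L2class; apply: filterS (L2classK f) => x fx.
by rewrite -[LHS]/(a * f x) -fx.
Qed.

Fact L2scaleA a b F : L2scale a (L2scale b F) = L2scale (a * b) F.
Proof. by rewrite -[F]L2repK -!L2classZ scalerA. Qed.

Fact L2scale1 : left_id 1 L2scale.
Proof. by move=> F; rewrite -[F]L2repK -L2classZ scale1r. Qed.

Fact L2scaleDr : right_distributive L2scale +%R.
Proof.
move=> a F G; rewrite -[F]L2repK -[G]L2repK.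
by rewrite -L2classD -!L2classZ -L2classD scalerDr.
Qed.

Fact L2scaleDl F : {morph L2scale^~ F : a b / a + b}.
Proof.
by move=> a b; rewrite -[F]L2repK -!L2classZ -L2classD scalerDl.
Qed.

HB.instance Definition _ := GRing.Zmodule_isLmodule.Build R[i] L2
  L2scaleA L2scale1 L2scaleDr L2scaleDl.

Lemma L2addE (F G : L2) : \forall x \ae mu, (F + G : L2) x = F x + G x.
Proof.
have <- : L2class (L2rep F + L2rep G) = F + G by rewrite L2classD !L2repK.
exact: L2classK.
Qed.

Lemma L2scaleE a (F : L2) : \forall x \ae mu, (a *: F : L2) x = a * F x.
Proof. exact: L2classK. Qed.

End L2_functions.

Section L2_inner_product.
Context d (X : measurableType d) (R : realType).
Variable mu : {measure set X -> \bar R}.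
Local Notation L2 := (@L2 d X R mu).

Definition cintegral (f : X -> R[i]) : R[i] :=
  (\int[mu]_x complex.Re (f x)) +i* (\int[mu]_x complex.Im (f x)).

Definition cintegrable (f : X -> R[i]) :=
  mu.-integrable setT (fun x => (complex.Re (f x))%:E) /\
  mu.-integrable setT (fun x => (complex.Im (f x))%:E).

Lemma cintegralD f g : cintegrable f -> cintegrable g ->
  cintegral (fun x => f x + g x) = cintegral f + cintegral g.
Proof.
move=> [fr fi] [gr gi]; apply/eqP; rewrite eq_complex /= -!RintegralD//.
by apply/andP; split; apply/eqP; apply: eq_Rintegral => x _;
  case: (f x) (g x) => [? ?] [? ?].
Qed.

Lemma cintegralZ a f : cintegrable f ->
  cintegral (fun x => a * f x) = a * cintegral f.
Proof.
case: a => a b [fr fi]; apply/eqP; rewrite eq_complex /= -!RintegralZl//.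
have iZ c (u : X -> R) : mu.-integrable setT (EFin \o u) ->
    mu.-integrable setT (EFin \o (fun x => c * u x)).
  by move=> iu; have := integrableZl measurableT c iu.
rewrite -RintegralB ?iZ// -RintegralD ?iZ//.
by apply/andP; split; apply/eqP; apply: eq_Rintegral => x _; case: (f x).
Qed.

Lemma cintegral_conj f : cintegrable f ->
  cintegral (fun x => conjc (f x)) = conjc (cintegral f).
Proof.
move=> [fr fi]; rewrite /cintegral /=; congr (_ +i* _).
  by apply: eq_Rintegral => x _; case: (f x).
rewrite -mulN1r -RintegralZl//.
by apply: eq_Rintegral => x _; rewrite mulN1r; case: (f x).
Qed.

Lemma ae_eq_cintegral f g : cmeasurable f -> cmeasurable g ->
  (\forall x \ae mu, f x = g x) -> cintegral f = cintegral g.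
Proof.
move=> [fr fi] [gr gi] fg; congr (_ +i* _); congr fine;
  apply: ae_eq_integral => //; do ?exact/measurable_EFinP;
  by apply: filterS fg => x -> _.
Qed.

Lemma L2_sqint (F : L2) : square_integrable mu F.
Proof. exact/sqintP/(valP (L2rep F)). Qed.

Lemma L2_measurable (F : L2) : cmeasurable F.
Proof. by case: (L2_sqint F). Qed.

Definition L2dot (F G : L2) : R[i] := cintegral (fun x => F x * conjc (G x)).

Lemma dot_measurable (F G : L2) : cmeasurable (fun x => F x * conjc (G x)).
Proof.
apply: cmeasurableM; first exact: L2_measurable.
exact/cmeasurable_conj/L2_measurable.
Qed.

Lemma dot_integrable (F G : L2) : cintegrable (fun x => F x * conjc (G x)).
Proof.
have [mr mi] := dot_measurable F G.
have [[[mF F2] [mG G2]]] := (L2_sqint F, L2_sqint G).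
have iS : mu.-integrable setT (fun x => (sqmod (F x) + sqmod (G x))%:E).
  have i1 (H : L2) : mu.-integrable setT (fun x => (sqmod (H x))%:E).
    have [mH H2] := L2_sqint H.
    apply/integrableP; split; first exact: measurable_sqmod.
    under eq_integral do rewrite gee0_abs ?lee_fin ?sqmod_ge0//.
    exact: H2.
  exact: (integrableD measurableT (i1 F) (i1 G)).
have dotle a b c e : `|a * c - b * - e| <= a ^+ 2 + b ^+ 2 + (c ^+ 2 + e ^+ 2) /\
    `|a * - e + b * c| <= a ^+ 2 + b ^+ 2 + (c ^+ 2 + e ^+ 2) :> R.
  have := (sqr_ge0 (a - c), sqr_ge0 (a + c), sqr_ge0 (b - e), sqr_ge0 (b + e)).
  have := (sqr_ge0 (a - e), sqr_ge0 (a + e), sqr_ge0 (b - c), sqr_ge0 (b + c)).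
  have := (sqr_ge0 a, sqr_ge0 b, sqr_ge0 c, sqr_ge0 e).
  move=> [[[? ?] ?] ?] [[[? ?] ?] ?] [[[? ?] ?] ?].
  by rewrite !ler_norml; split; apply/andP; split; lra.
split; (apply: le_integrable iS => //; first exact/measurable_EFinP);
  move=> x _; rewrite lee_fin/= [leRHS]ger0_norm;
  try (by apply: addr_ge0; exact: sqmod_ge0);
  by case: (F x) (G x) => [a b] [c e]; case: (dotle a b c e).
Qed.

Fact L2dot_linearl (H : L2) : scalar (L2dot^~ H).
Proof.
move=> a F' G'; pose F : L2 := F'; pose G : L2 := G'.
rewrite -[F']/F -[G']/G /L2dot -cintegralZ; last exact: dot_integrable.
have [ir ii] := dot_integrable (a *: F) H.
have FZ : \forall x \ae mu, (a *: F : L2) x * conjc (H x) =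
    a * (F x * conjc (H x)).
  by apply: filterS (L2scaleE a F) => x ->; rewrite mulrA.
rewrite -(ae_eq_cintegral _ _ FZ); [|exact: dot_measurable|]; last first.
  by apply: cmeasurableM; [exact: cmeasurable_cst|exact: dot_measurable].
rewrite -cintegralD; [|exact: dot_integrable..].
apply: ae_eq_cintegral; first exact: dot_measurable.
  by apply: cmeasurableD; exact: dot_measurable.
by apply: filterS (L2addE (a *: F) G) => x ->; rewrite mulrDl.
Qed.

Fact L2dot_herm (F G : L2) :
  L2dot F G = (-1) ^+ false * Num.conj (L2dot G F).
Proof.
rewrite expr0 mul1r -[RHS]/(conjc _) -cintegral_conj; last exact: dot_integrable.
congr cintegral; apply/funext => x; case: (F x) (G x) => [a b] [c e].
by apply/eqP; rewrite eq_complex; apply/andP; split; apply/eqP => /=; ring.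
Qed.

Fact L2dot_linearr (F : L2) : GRing.linear_for (Num.conj \; *%R) (L2dot F).
Proof.
move=> a G H; rewrite L2dot_herm [in RHS]L2dot_herm [L2dot F H]L2dot_herm.
by rewrite !expr0 !mul1r L2dot_linearl rmorphD rmorphM.
Qed.

HB.instance Definition _ := bilinear_isBilinear.Build R[i] L2 L2 R[i] _ _ L2dot
  (L2dot_linearl, L2dot_linearr).

HB.instance Definition _ := isHermitianSesquilinear.Build R[i] L2 false
  Num.conj L2dot L2dot_herm.

Lemma L2dotE (F : L2) : L2dot F F = (\int[mu]_x sqmod (F x))%:C.
Proof.
congr (_ +i* _).
  by apply: eq_Rintegral => x _; case: (F x) => a b; rewrite /sqmod /=; ring.
rewrite (@eq_Rintegral _ _ _ mu _ (cst 0)); first by rewrite /Rintegral integral0.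
by move=> x _; case: (F x) => a b /=; ring.
Qed.

Fact L2dot_gt0 (F : L2) : F != 0 -> 0 < L2dot F F.
Proof.
move=> F0; rewrite L2dotE ltcR lt_def Rintegral_ge0 ?andbT//; last first.
  by move=> x _; exact: sqmod_ge0.
apply: contra F0 => /eqP F2.
have [mF F2fin] := L2_sqint F.
have F2E : (\int[mu]_x (sqmod (F x))%:E = 0)%E.
  rewrite -[LHS]fineK ?F2//; first by rewrite -[X in X%:E]/(\int[mu]_x _) F2.
  by rewrite ge0_fin_numE// integral_ge0// => x _; rewrite lee_fin sqmod_ge0.
have := (ae_eq_integral_abs mu measurableT (measurable_sqmod mF)).1.
under eq_integral do rewrite gee0_abs ?lee_fin ?sqmod_ge0//.
move=> /(_ F2E) F0; apply/eqP; rewrite -[F]L2repK.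
rewrite -L2class0; apply/eq_L2class; apply: filterS F0 => x /(_ I).
by move=> [/eqP]; rewrite sqmod_eq0 => /eqP.
Qed.

HB.instance Definition _ := isDotProduct.Build R[i] L2 L2dot L2dot_gt0.

End L2_inner_product.
Arguments L2dot {d X R} mu F G.

Section direct_sum.
Context (R : realType) (I : finType) (V : lmodType R[i]).
Variable dV : {dot V for Num.conj}.

Definition sumdot (f g : {ffun I -> V}) : R[i] := \sum_i dV (f i) (g i).

Fact sumdot_herm f g : sumdot f g = (-1) ^+ false * Num.conj (sumdot g f).
Proof.
rewrite expr0 mul1r rmorph_sum; apply: eq_bigr => i _ /=.
by rewrite [LHS]hermitian_subproof expr0 mul1r.
Qed.

Fact sumdot_linearl g : scalar (sumdot^~ g).
Proof.
move=> a f f'; rewrite /sumdot mulr_sumr -big_split; apply: eq_bigr => i _ /=.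
by rewrite !ffunE linearPl.
Qed.

Fact sumdot_linearr f : GRing.linear_for (Num.conj \; *%R) (sumdot f).
Proof.
move=> a g h; rewrite sumdot_herm [in RHS]sumdot_herm [sumdot f h]sumdot_herm.
by rewrite !expr0 !mul1r sumdot_linearl rmorphD rmorphM.
Qed.

HB.instance Definition _ := bilinear_isBilinear.Build R[i] {ffun I -> V}
  {ffun I -> V} R[i] _ _ sumdot (sumdot_linearl, sumdot_linearr).

HB.instance Definition _ := isHermitianSesquilinear.Build R[i] {ffun I -> V}
  false Num.conj sumdot sumdot_herm.

Fact sumdot_gt0 f : f != 0 -> 0 < sumdot f f.
Proof.
move=> f0; rewrite lt_def sumr_ge0 ?andbT; last by move=> i _; exact: dnorm_ge0.
apply: contra f0; rewrite psumr_eq0 => [/allP f0|i _]; last exact: dnorm_ge0.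
apply/eqP/ffunP => i; rewrite ffunE; apply/eqP.
by rewrite -(dnorm_eq0 dV) (implyP (f0 i _))// mem_index_enum.
Qed.

HB.instance Definition _ :=
  isDotProduct.Build R[i] {ffun I -> V} sumdot sumdot_gt0.

End direct_sum.

(* A possibly unbounded operator from U to V is represented by its graph, so   *)
(* equality of operators includes equality of their domains.                   *)
Definition operator (U V : Type) := set (U * V).

Section operators.
Context {R : realType}.

Definition dom (U V : Type) (T : operator U V) : set U :=
  [set u | exists v, T (u, v)].

Definition ker (U : Type) (V : lmodType R[i]) (T : operator U V) : set U :=
  [set u | T (u, 0)].

Definition comp_op (U V W : Type) (S : operator V W) (T : operator U V) :
    operator U W :=
  [set p | exists v, T (p.1, v) /\ S (v, p.2)].

Definition is_linear_op (U V : lmodType R[i]) (T : operator U V) :=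
  [/\ T (0, 0),
      forall (a : R[i]) p q, T p -> T q -> T (a *: p + q)
    & forall u v w, T (u, v) -> T (u, w) -> v = w].

Definition zero_op (U V : lmodType R[i]) : operator U V :=
  [set p | p.2 = 0].

Definition column_op (I : finType) (U V : Type) (T : I -> operator U V) :
    operator U {ffun I -> V} :=
  [set p : U * {ffun I -> V} | forall i, T i (p.1, p.2 i)].

Definition entry_op (I : finType) (U V : Type)
    (T : operator U {ffun I -> V}) (i : I) : operator U V :=
  [set p | exists w : {ffun I -> V}, T (p.1, w) /\ w i = p.2].

Definition pair_op (U V : Type) (T0 T1 : operator U V) : 'I_2 -> operator U V :=
  fun i => if i == ord0 then T0 else T1.

Definition dnorm (U : lmodType R[i]) (dU : {dot U for Num.conj}) (u : U) : R :=
  Num.sqrt (complex.Re (dU u u)).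

Definition densely_defined (U : lmodType R[i]) (V : Type)
    (dU : {dot U for Num.conj}) (T : operator U V) :=
  forall (u : U) (e : R), 0 < e -> exists2 v, dom T v & dnorm dU (u - v) < e.

Section two_spaces.
Context (U V : lmodType R[i]).
Variables (dU : {dot U for Num.conj}) (dV : {dot V for Num.conj}).

(* This is the graph of the Hilbert space adjoint when T is densely defined.   *)
Definition adjoint (T : operator U V) : operator V U :=
  [set p | forall u v, T (u, v) -> dV v p.1 = dU u p.2].

Definition op_norm (T : operator U V) : \bar R :=
  ereal_sup [set (dnorm dV p.2)%:E | p in [set p | T p /\ dnorm dU p.1 <= 1]].

Definition partial_isometry (T : operator U V) :=
  [/\ is_linear_op T, dom T = setT, (op_norm T < +oo)%E
    & forall u v, T (u, v) -> (forall k, ker T k -> dU u k = 0) ->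
        dnorm dV v = dnorm dU u].

End two_spaces.

Definition selfadjoint (U : lmodType R[i]) (dU : {dot U for Num.conj})
    (S : operator U U) :=
  densely_defined dU S /\ adjoint dU dU S = S.

Definition positive_op (U : lmodType R[i]) (dU : {dot U for Num.conj})
    (S : operator U U) :=
  forall u v, S (u, v) -> 0 <= dU v u.

Section polar.
Context (U V : lmodType R[i]).
Variables (dU : {dot U for Num.conj}) (dV : {dot V for Num.conj}).

(* On a Hilbert space the positive selfadjoint square root, and the partial    *)
(* isometry of the polar decomposition, are unique, so xget makes no arbitrary *)
(* choice; its default set0 is not the graph of a linear operator.             *)
Definition sqrt_op (A : operator U U) : operator U U :=
  xget set0 [set S | [/\ selfadjoint dU S, positive_op dU S & comp_op S S = A]].

Definition abs_op (T : operator U V) : operator U U :=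
  sqrt_op (comp_op (adjoint dU dV T) T).

Definition polar_factor (T : operator U V) : operator U V :=
  xget set0 [set W | [/\ partial_isometry dU dV W, ker W = ker T
                       & T = comp_op W (abs_op T)]].

End polar.
End operators.
Arguments zero_op {R} U V.

Section weighted_composition.
Context d (X : measurableType d) (R : realType).
Variable mu : {measure set X -> \bar R}.
Implicit Types (phi : X -> X) (omega g : X -> R[i]) (h : X -> \bar R).

Definition wmeasure omega (A : set X) : \bar R :=
  (\int[mu]_(x in A) (sqmod (omega x))%:E)%E.

Definition image_wmeasure phi omega (A : set X) : \bar R :=
  wmeasure omega (phi @^-1` A).

Definition wco_symbol phi omega :=
  [/\ measurable_fun setT phi, cmeasurable omega
    & image_wmeasure phi omega `<< mu].

Definition wco_density phi omega h :=
  [/\ measurable_fun setT h, forall x, (0 <= h x)%E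
    & forall A, measurable A ->
        image_wmeasure phi omega A = (\int[mu]_(x in A) h x)%E].

(* p.1 and p.2 are coerced to chosen representatives of their classes; under   *)
(* wco_symbol phi omega the relation does not depend on the choice.            *)
Definition wco phi omega : operator (L2 mu) (L2 mu) :=
  [set p : L2 mu * L2 mu | \forall x \ae mu, p.2 x = omega x * p.1 (phi x)].

Definition mul_op g : operator (L2 mu) (L2 mu) :=
  [set p : L2 mu * L2 mu | \forall x \ae mu, p.2 x = g x * p.1 x].

(* The square root of an extended nonnegative function as a complex function;  *)
(* the value 0 taken where h is +oo only matters up to null sets when the      *)
(* operators are densely defined.                                              *)
Definition csqrt h (x : X) : R[i] := (Num.sqrt (fine (h x)))%:C.

End weighted_composition.
Arguments wco {d X R} mu phi omega.
Arguments mul_op {d X R} mu g.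

(* Main.v *)
Require Import Defs.
From HB Require Import structures.
From mathcomp Require Import all_boot all_order all_algebra.
From mathcomp Require Import sesquilinear complex.
From mathcomp Require Import all_classical all_reals all_analysis.
From mathcomp Require Import measurable_realfun ess_sup_inf lebesgue_Rintegral.
From mathcomp Require Import ring lra.

(** Let [int k |f|^2] denote the integral over X of k |f|^2 with respect to mu.
    All the operators of the theorem are of one kind: there is a weight k such
    that the domain of T consists of the F with [int k |F|^2] finite and the
    squared norm of T F is [int k |F|^2] ([has_form]).  Change of variables
    ([wco_density_integral]) gives the weighted composition operator with density
    h the weight h ([has_form_wco]), weights add up when operators are stacked in
    a column ([has_form_column]), and multiplication by sqrt k has weight k
    ([has_form_mul_op]).  A dense domain forces the weight to be finite almost
    everywhere ([dense_weight_fin]).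

    Polarization recovers the inner products of the values of T from the weight
    ([has_form_dot]), so an operator of weight k satisfies
    T^* T = M^* M = M M, where M is multiplication by sqrt k.  This gives
    |T| = M, provided that M is the only positive selfadjoint square root of
    M M.  That uniqueness is proved without the spectral theorem
    ([sqrt_mul_op_unique]).  Let M be multiplication by g and let S be another
    root.  The bounded map B = S (1 + S^2)^-1 has the same square as
    multiplication by b = g / (1 + g^2).  It commutes with multiplication by b^2,
    hence with multiplication by b, which is a uniform limit of polynomials in
    b^2 ([commute_mulL2_sqrt]); and two commuting positive square roots of the
    same map coincide ([commuting_sqrt_unique]).  From the equality of these
    bounded maps one gets that M extends S, and then that S extends M by taking
    adjoints.

    For the polar decomposition, dividing the weights omega_i by
    sqrt (hh o phi_i), where hh is the sum of the densities, turns the densities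
    h_i into h_i / hh on the support of hh.  The column W of the resulting
    operators has as weight the indicator of that support, so it is a partial
    isometry whose kernel is that of the given column, and composing it with
    multiplication by sqrt hh gives the given column back.  These properties
    determine W, since the kernel of W and the range of multiplication by sqrt hh
    together span a dense subspace ([polar_factor_unique]).  Finally, an everywhere
    defined operator with a bounded weight k has as norm the square root of the
    essential supremum of k ([op_norm_has_form]). *)

Set Implicit Arguments.
Unset Strict Implicit.
Unset Printing Implicit Defensive.

Import Order.TTheory GRing.Theory Num.Theory.
Import numFieldNormedType.Exports.

Local Open Scope classical_set_scope.
Local Open Scope complex_scope.
Local Open Scope ring_scope.

(** * Calculus in L2 *)

Section L2_calculus.
Context d (X : measurableType d) (R : realType).
Variable mu : {measure set X -> \bar R}.
Local Notation L2 := (@L2 d X R mu).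
Implicit Types (F G : L2) (f : X -> R[i]) (u : X -> R) (k : X -> \bar R).

Lemma sqmodR (a : R) (z : R[i]) : sqmod (a%:C * z) = a ^+ 2 * sqmod z.
Proof. by rewrite sqmodM /sqmod /= expr0n /= addr0. Qed.

Lemma cmeasurable_real u : measurable_fun setT u ->
  cmeasurable (fun x => (u x)%:C).
Proof. by move=> mu_; split => //=; exact: measurable_cst. Qed.

(** The value on functions that are not square-integrable is the class of 0. *)
Definition L2of f : L2 := L2class (insubd 0 f).

Lemma L2ofE f : square_integrable mu f -> \forall x \ae mu, L2of f x = f x.
Proof.
move=> /sqintP f2; apply: filterS (L2classK (insubd (0 : L2fun mu) f)) => x.
rewrite /L2of => ->; by have := insubdK (0 : L2fun mu) f2 => ->.
Qed.

Lemma L20E : \forall x \ae mu, (0 : L2) x = 0.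
Proof.
by rewrite -(@L2class0 _ _ _ mu); apply: filterS (L2classK (0 : L2fun mu)) => x ->.
Qed.

Lemma L2subE F G : \forall x \ae mu, (F - G : L2) x = F x - G x.
Proof.
rewrite -scaleN1r; apply: filterS2 (L2addE F (-1 *: G)) (L2scaleE (-1) G) => x.
by move=> -> ->; rewrite mulN1r.
Qed.

Lemma eq_L2dot F G F' G' :
  (\forall x \ae mu, F x * conjc (G x) = F' x * conjc (G' x)) ->
  L2dot mu F G = L2dot mu F' G'.
Proof. by move=> ?; apply: ae_eq_cintegral => //; exact: dot_measurable. Qed.

Lemma L2dotBl F F' G : L2dot mu (F - F') G = L2dot mu F G - L2dot mu F' G.
Proof. exact: (linearBl (L2dot mu)). Qed.

(** The weight is extended-valued because densities of image measures are; the
    product of +oo and 0 is 0, so that functions vanishing where the weight is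
    infinite may have a finite form. *)
Definition qform k (f : X -> R[i]) : \bar R :=
  (\int[mu]_x (k x * (sqmod (f x))%:E))%E.

Lemma qform_ge0 k f : (forall x, 0 <= k x)%E -> (0 <= qform k f)%E.
Proof.
by move=> k0; apply: integral_ge0 => x _; rewrite mule_ge0// lee_fin sqmod_ge0.
Qed.

Lemma measurable_qform k f : measurable_fun setT k -> cmeasurable f ->
  measurable_fun setT (fun x => k x * (sqmod (f x))%:E)%E.
Proof. by move=> mk mf; apply: emeasurable_funM => //; exact: measurable_sqmod. Qed.

Lemma ae_eq_qform k k' f f' : measurable_fun setT k -> measurable_fun setT k' ->
  cmeasurable f -> cmeasurable f' ->
  (\forall x \ae mu, k x * (sqmod (f x))%:E = k' x * (sqmod (f' x))%:E)%E ->
  qform k f = qform k' f'.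
Proof.
move=> mk mk' mf mf' h; apply: ae_eq_integral => //; do ?exact: measurable_qform.
by apply: filterS h => x -> _.
Qed.

Lemma qform1 F : qform (cst 1%E) F = (complex.Re (L2dot mu F F))%:E.
Proof.
rewrite L2dotE /= /qform (eq_integral (fun x => (sqmod (F x))%:E)); last first.
  by move=> x _; rewrite mul1e.
have [_ F2] := L2_sqint F; rewrite /Rintegral fineK//.
by rewrite ge0_fin_numE// integral_ge0// => x _; rewrite lee_fin sqmod_ge0.
Qed.

Lemma square_integrableE f : cmeasurable f ->
  square_integrable mu f <-> (qform (cst 1%E) f < +oo)%E.
Proof.
move=> mf; rewrite /qform (eq_integral (fun x => (sqmod (f x))%:E)); last first.
  by move=> x _; rewrite mul1e.
by split=> [[]|].
Qed.

Lemma le_qform k k' f : measurable_fun setT k -> measurable_fun setT k' ->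
  cmeasurable f -> (forall x, 0 <= k x)%E -> (forall x, 0 <= k' x)%E ->
  (\forall x \ae mu, k x <= k' x)%E -> (qform k f <= qform k' f)%E.
Proof.
move=> mk mk' mf k0 k'0 kk'.
apply: ae_ge0_le_integral => //; do ?exact: measurable_qform.
- by move=> x _; rewrite mule_ge0// lee_fin sqmod_ge0.
- by move=> x _; rewrite mule_ge0// lee_fin sqmod_ge0.
- by apply: filterS kk' => x kk' _; rewrite lee_wpmul2r// lee_fin sqmod_ge0.
Qed.

Lemma qformZ k f (c : R) : 0 <= c -> measurable_fun setT k -> (forall x, 0 <= k x)%E ->
  cmeasurable f -> qform (fun x => c%:E * k x)%E f = (c%:E * qform k f)%E.
Proof.
move=> c0 mk k0 mf; rewrite /qform -ge0_integralZl_EFin//.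
- by apply: eq_integral => x _; rewrite muleA.
- by move=> x _; rewrite mule_ge0// lee_fin sqmod_ge0.
- exact: measurable_qform.
Qed.

Lemma square_integrableM u f : measurable_fun setT u -> cmeasurable f ->
  square_integrable mu (fun x => (u x)%:C * f x) <->
  (qform (fun x => (u x ^+ 2)%:E) f < +oo)%E.
Proof.
move=> mu_ mf; rewrite square_integrableE; last first.
  by apply: cmeasurableM => //; exact: cmeasurable_real.
rewrite /qform (eq_integral (fun x => ((u x ^+ 2)%:E * (sqmod (f x))%:E)%E))//.
by move=> x _; rewrite mul1e sqmodR EFinM.
Qed.

Definition mulL2 u F : L2 := L2of (fun x => (u x)%:C * F x).

Lemma mulL2E u F : square_integrable mu (fun x => (u x)%:C * F x) ->
  \forall x \ae mu, mulL2 u F x = (u x)%:C * F x.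
Proof. exact: L2ofE. Qed.

Definition bounded_mult u :=
  measurable_fun setT u /\ exists M, forall x, `|u x| <= M.

Lemma bounded_mult_sqint u F : bounded_mult u ->
  square_integrable mu (fun x => (u x)%:C * F x).
Proof.
move=> [mu_ [M uM]]; have mF := L2_measurable F.
apply/square_integrableM => //.
have m1 : measurable_fun setT (cst 1%E : X -> \bar R) by exact: measurable_cst.
apply: (@le_lt_trans _ _ (qform (fun x => (M ^+ 2)%:E * cst 1%E x)%E F)).
  apply: le_qform => //.
  - by apply/measurable_EFinP; exact: measurable_funX.
  - by move=> x; rewrite lee_fin sqr_ge0.
  - by move=> x; rewrite mule1 lee_fin sqr_ge0.
  - apply: nearW => x; rewrite mule1 lee_fin -real_normK ?num_real//.
    by rewrite ler_pXn2r// ?nnegrE// (le_trans _ (uM x)).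
rewrite qformZ ?sqr_ge0//; first by rewrite qform1 ltry.
Qed.

Lemma bounded_mulL2E u F : bounded_mult u ->
  \forall x \ae mu, mulL2 u F x = (u x)%:C * F x.
Proof. by move=> bu; exact/mulL2E/bounded_mult_sqint. Qed.

Lemma mulL2_sym u F G : bounded_mult u ->
  L2dot mu (mulL2 u F) G = L2dot mu F (mulL2 u G).
Proof.
move=> bu; apply: eq_L2dot.
apply: filterS2 (bounded_mulL2E F bu) (bounded_mulL2E G bu) => x -> ->.
case: (F x) (G x) => [a b] [c e] /=.
by apply/eqP; rewrite eq_complex /=; apply/andP; split; apply/eqP; ring.
Qed.

Lemma bounded_multM u v : bounded_mult u -> bounded_mult v ->
  bounded_mult (fun x => u x * v x).
Proof.
move=> [mu_ [M uM]] [mv [N vN]]; split; first exact: measurable_funM.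
by exists (M * N) => x; rewrite normrM ler_pM.
Qed.

Lemma bounded_mult_indic (A : set X) : measurable A ->
  bounded_mult (\1_A : X -> R).
Proof.
move=> mA; split; first exact: measurable_indic.
by exists 1 => x; rewrite indicE normr_nat lern1 leq_b1.
Qed.

Lemma dnorm_lt F (e : R) : 0 < e ->
  (qform (cst 1%E) F < (e ^+ 2)%:E)%E -> dnorm (L2dot mu) F < e.
Proof.
move=> e0; rewrite qform1 lte_fin /dnorm => h.
by rewrite -(ger0_norm (ltW e0)) -sqrtr_sqr ltr_sqrt// exprn_gt0.
Qed.

(** The squared error is the integral of |F|^2 off E n, which tends to 0 by
    dominated convergence.  This is the source of all density statements below. *)
Lemma L2_truncation F (E : nat -> set X) (e : R) : (forall n, measurable (E n)) ->
  (\forall x \ae mu, F x != 0 -> \forall n \near \oo, E n x) -> 0 < e ->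
  exists n, dnorm (L2dot mu) (F - mulL2 \1_(E n) F) < e.
Proof.
move=> mE hE e0; have [mF F2] := L2_sqint F.
pose f_ n x := ((\1_(~` E n) x)%:E * (sqmod (F x))%:E)%E.
have mf_ n : measurable_fun setT (f_ n).
  apply: emeasurable_funM; last exact: measurable_sqmod.
  by apply/measurable_EFinP/measurable_indic/measurableC.
have iF : mu.-integrable setT (fun x => (sqmod (F x))%:E).
  apply/integrableP; split; first exact: measurable_sqmod.
  by under eq_integral do rewrite gee0_abs ?lee_fin ?sqmod_ge0//.
have f_0 : {ae mu, forall x, setT x -> f_ ^~ x @ \oo --> (cst 0%E : X -> \bar R) x}.
  apply: filterS hE => x hx _.
  have [F0|F0] := eqVneq (F x) 0.
    rewrite /f_ F0 (_ : sqmod 0 = 0).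
      by under eq_fun do rewrite mule0; exact: cvg_cst.
    by apply/eqP; rewrite sqmod_eq0.
  apply: cvg_near_cst; apply: filterS (hx F0) => n En.
  by rewrite /f_ indicE (_ : x \in ~` E n = false) ?mul0e//; apply/memNset; apply.
have f_F : {ae mu, forall x n, setT x -> (`|f_ n x| <= (sqmod (F x))%:E)%E}.
  apply: nearW => x n _; rewrite /f_ gee0_abs ?mule_ge0 ?lee_fin ?sqmod_ge0//.
  by rewrite ler_piMl ?sqmod_ge0// indicE lern1 leq_b1.
have [_ _] := dominated_convergence measurableT mf_ (measurable_cst _) f_0 iF f_F.
rewrite integral0 => h.
have : \forall n \near \oo, (\int[mu]_x (f_ n x) < (e ^+ 2)%:E)%E.
  apply: (h [set y | (y < (e ^+ 2)%:E)%E]); apply: open_nbhs_nbhs; split; first exact: open_ereal_lt_ereal.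
  by rewrite /= lte_fin exprn_gt0.
move=> [n _ /(_ n (leqnn n)) hn]; exists n; apply: dnorm_lt => //.
apply: le_lt_trans hn; rewrite le_eqVlt; apply/orP; left; apply/eqP.
have m1 : measurable_fun setT (cst 1%E : X -> \bar R) by exact: measurable_cst.
apply: (@ae_eq_qform (cst 1%E) (fun x => (\1_(~` E n) x)%:E) _ F) => //.
- by apply/measurable_EFinP/measurable_indic/measurableC.
- exact: L2_measurable.
have bE := bounded_mult_indic (mE n).
apply: filterS2 (L2subE F (mulL2 \1_(E n) F)) (bounded_mulL2E F bE) => x -> ->.
rewrite mul1e -EFinM; congr EFin; rewrite indicC.
have -> : F x - (\1_(E n) x)%:C * F x = (1 - \1_(E n) x)%:C * F x.
  by rewrite rmorphB /= mulrBl mul1r.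
rewrite sqmodR; congr (_ * _); rewrite /= indicE; case: (_ \in _) => /=.
  by rewrite subrr expr0n.
by rewrite subr0 expr1n.
Qed.

End L2_calculus.

(** * Commuting positive square roots *)

Section symmetric_maps.
Context (R : realType) (V : lmodType R[i]) (dV : {dot V for Num.conj}).
Implicit Types (B P : V -> V) (x y z : V).

Definition symmetric_map B := forall x y, dV (B x) y = dV x (B y).

Lemma dot_nondeg x y : (forall z, dV x z = dV y z) -> x = y.
Proof.
move=> xy; apply/eqP; rewrite -subr_eq0 -(dnorm_eq0 dV).
by rewrite linearBl /= xy subrr.
Qed.

(** An everywhere defined symmetric map is automatically linear, because it can
    be moved to the other argument of the inner product; so S (1 + S^2)^-1 can be
    handled as a mere choice function. *)
Lemma symmetric_map_linear B : symmetric_map B -> linear B.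
Proof.
move=> sB a x y; apply: dot_nondeg => z.
by rewrite linearPl /= !sB linearPl.
Qed.

(** Since B and P commute and have the same square, y = (B - P) x lies in the
    kernel of B + P; by positivity it lies in both kernels, so that
    <y, y> = <x, (B - P) y> = 0.  The condition on the kernel of P replaces the
    Cauchy-Schwarz inequality for positive forms; it is immediate when P is a
    multiplication. *)
Lemma commuting_sqrt_unique B P : symmetric_map B -> symmetric_map P ->
  (forall x, 0 <= dV (B x) x) -> (forall x, 0 <= dV (P x) x) ->
  (forall x, dV (P x) x = 0 -> P x = 0) ->
  (forall x, B (B x) = P (P x)) -> (forall x, B (P x) = P (B x)) ->
  forall x, B x = P x.
Proof.
move=> sB sP B0 P0 Pker BB BP x.
have lB y z : B (y - z) = B y - B z.
  by rewrite addrC -scaleN1r (symmetric_map_linear sB) scaleN1r addrC.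
have lP y z : P (y - z) = P y - P z.
  by rewrite addrC -scaleN1r (symmetric_map_linear sP) scaleN1r addrC.
pose y := B x - P x.
have BPy : B y + P y = 0.
  by rewrite /y lB lP BB BP -[P (P x) - _]opprB addNr.
have Py0 : P y = 0.
  apply: Pker; apply/eqP; rewrite eq_le P0 andbT.
  have : dV (B y) y + dV (P y) y = 0 by rewrite -linearDl BPy linear0l.
  by move=> /eqP; rewrite addr_eq0 => /eqP By; rewrite -oppr_ge0 -By.
have By0 : B y = 0 by move: BPy; rewrite Py0 addr0.
apply/eqP; rewrite -subr_eq0 -(dnorm_eq0 dV) -/y {1}/y linearBl /= sB sP.
by rewrite By0 Py0 linear0r subrr.
Qed.

End symmetric_maps.

Section square_root.
Context d (X : measurableType d) (R : realType).
Variable mu : {measure set X -> \bar R}.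
Local Notation L2 := (@L2 d X R mu).
Implicit Types (F G : L2) (b g u : X -> R).

Local Notation normsq F := (complex.Re (L2dot mu F F)).

Lemma normsq_ge0 F : 0 <= normsq F.
Proof. by rewrite L2dotE; apply: Rintegral_ge0 => x _; exact: sqmod_ge0. Qed.

Lemma normsq_eq0 F : normsq F = 0 -> F = 0.
Proof.
move=> F0; apply/eqP; rewrite -(dnorm_eq0 (L2dot mu)) -[X in X == _]/(L2dot mu F F).
by rewrite L2dotE; move: F0; rewrite L2dotE /= => ->.
Qed.

(** Expand the squared norms of uF + cG and uF - cG, which are nonnegative. *)
Lemma Re_dot_mulL2_le u (c : R) F G : measurable_fun setT u -> 0 < c ->
  (forall x, `|u x| <= c) ->
  `|complex.Re (L2dot mu (mulL2 u F) G)| <= c * (normsq F + normsq G).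
Proof.
move=> mu_ c0 uc.
have bu : bounded_mult u by split => //; exists c.
have m1 : measurable_fun setT (cst 1%E : X -> \bar R) by exact: measurable_cst.
have uF : normsq (mulL2 u F) <= c ^+ 2 * normsq F.
  rewrite -lee_fin EFinM -!qform1 -qformZ ?sqr_ge0//; last exact: L2_measurable.
  have -> : qform mu (cst 1%E) (mulL2 u F) = qform mu (fun x => (u x ^+ 2)%:E) F.
    apply: ae_eq_qform => //; do ?exact: L2_measurable.
      by apply/measurable_EFinP; exact: measurable_funX.
    by apply: filterS (bounded_mulL2E F bu) => x ->; rewrite mul1e sqmodR.
  apply: le_qform => //.
  - by apply/measurable_EFinP; exact: measurable_funX.
  - exact: L2_measurable.
  - by move=> x; rewrite lee_fin sqr_ge0.
  - by move=> x; rewrite mule1 lee_fin sqr_ge0.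
  - apply: nearW => x; rewrite mule1 lee_fin -real_normK ?num_real//.
    by rewrite ler_pXn2r// ?nnegrE// ltW.
have key (s : R) : s ^+ 2 = 1 ->
    0 <= normsq (mulL2 u F) + (c ^+ 2 * normsq G
      + 2 * s * c * complex.Re (L2dot mu (mulL2 u F) G)).
  move=> s1; have := normsq_ge0 (mulL2 u F + (s * c)%:C *: G).
  rewrite dnormD linearZl_LR !linearZr_LR /=.
  move: (L2dot mu (mulL2 u F) G) (L2dot mu (mulL2 u F) (mulL2 u F)) (L2dot mu G G).
  move=> [a1 a2] [b1 b2] [e1 e2] /=.
  have <- : (s * c) ^+ 2 = c ^+ 2 by rewrite exprMn s1 mul1r.
  move=> h; apply: le_trans h _; lra.
have := key 1 (expr1n _ _).
have : (-1) ^+ 2 = 1 :> R by rewrite sqrrN expr1n.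
move=> /key.
have := normsq_ge0 F; have := normsq_ge0 G; move: uF.
move: (normsq (mulL2 u F)) (normsq F) (normsq G) (complex.Re _).
clear -c0 => N NF NG w uF NG0 NF0 k1 k2.
have cF : 0 <= c ^+ 2 * NF by rewrite mulr_ge0// sqr_ge0.
have cG : 0 <= c ^+ 2 * NG by rewrite mulr_ge0// sqr_ge0.
by rewrite ler_norml -(ler_pM2l c0) -[X in _ && X](ler_pM2l c0); apply/andP; split; lra.
Qed.

(** Each iterate is a polynomial in b^2; the iteration is the classical one that
    increases to the square root of its parameter, here b^2. *)
Fixpoint sqrt_iter b n x : R :=
  if n is n'.+1 then
    sqrt_iter b n' x + (b x ^+ 2 - sqrt_iter b n' x ^+ 2) / 2
  else 0.

(** The errors e_n = b - q_n satisfy e_(n+1) = e_n (1 - (b + q_n) / 2)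
    <= e_n - e_n^2 / 2, whence the rate 2 / (n + 2), uniform in x. *)
Lemma sqrt_iter_bounds b n x : 0 <= b x <= 1 ->
  0 <= sqrt_iter b n x <= b x /\ b x - sqrt_iter b n x <= 2 / n.+2%:R.
Proof.
move=> /andP[b0 b1]; elim: n => [|n [/andP[q0 qb] qn]] /=.
  by rewrite lexx b0 subr0 divff.
move: qn; set q := sqrt_iter b n x in q0 qb *; set e := b x - q => en.
have e0 : 0 <= e by rewrite subr_ge0.
split; first by apply/andP; split; rewrite /e in e0; nra.
(* the map sending y to y - y^2 / 2 increases on [0, 1], so it suffices to
   evaluate it at the bound t *)
pose t : R := 2 / n.+2%:R; pose t' : R := 2 / n.+3%:R.
have t1 : t <= 1 by rewrite /t ler_pdivrMr ?ltr0n// mul1r ler_nat.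
have tt : t - t ^+ 2 / 2 <= t'.
  rewrite /t /t' -subr_ge0.
  have -> : 2 / n.+3%:R - (2 / n.+2%:R - (2 / n.+2%:R) ^+ 2 / 2)
     = 2 / (n.+3%:R * n.+2%:R ^+ 2) :> R.
    have -> : n.+3%:R = n.+2%:R + 1 :> R by rewrite natr1.
    have n2 : 0 < n.+2%:R :> R by rewrite ltr0n.
    by field; rewrite !gt_eqF// ltr_wpDl// ltW.
  by rewrite divr_ge0// mulr_ge0// sqr_ge0.
have e1 : e <= t by [].
apply: le_trans tt.
have -> : b x - (q + (b x ^+ 2 - q ^+ 2) / 2) = e * (1 - (b x + q) / 2).
  by rewrite /e; field.
have h : e <= b x + q by rewrite /e; lra.
nra.
Qed.

Lemma measurable_sqrt_iter b n : measurable_fun setT b ->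
  measurable_fun setT (sqrt_iter b n).
Proof.
move=> mb; elim: n => [|n IH] /=; first exact: measurable_cst.
apply: measurable_funD => //; apply: measurable_funM; last exact: measurable_cst.
by apply: measurable_funB; exact: measurable_funX.
Qed.

(** B commutes with the polynomials in b^2, which converge uniformly to b.  The
    limit is taken inside inner products, so that B need not be known to be
    continuous. *)
Lemma commute_mulL2_sqrt (B : L2 -> L2) b : symmetric_map (L2dot mu) B ->
  measurable_fun setT b -> (forall x, 0 <= b x <= 1) ->
  (forall F, B (mulL2 (fun x => b x ^+ 2) F) = mulL2 (fun x => b x ^+ 2) (B F)) ->
  forall F, B (mulL2 b F) = mulL2 b (B F).
Proof.
move=> sB mb b01 Bb2 F; have lB := symmetric_map_linear sB.
have lBB y z : B (y - z) = B y - B z.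
  by rewrite addrC -scaleN1r lB scaleN1r addrC.
have bb : bounded_mult b.
  split => //; exists 1 => x; have /andP[? ?] := b01 x.
  by rewrite ger0_norm.
have bb2 : bounded_mult (fun x => b x ^+ 2) by exact: bounded_multM.
have mq n := measurable_sqrt_iter n mb.
have bq n : bounded_mult (sqrt_iter b n).
  split => //; exists 1 => x; have /andP[? ?] := b01 x.
  have [/andP[? ?] _] := sqrt_iter_bounds n (b01 x).
  by rewrite ger0_norm// (le_trans _ (_ : b x <= 1)).
have qS n G : mulL2 (sqrt_iter b n.+1) G = 2^-1%:C *: (mulL2 (fun x => b x ^+ 2) G
    - mulL2 (sqrt_iter b n) (mulL2 (sqrt_iter b n) G)) + mulL2 (sqrt_iter b n) G.
  apply/L2P.
  have h1 := bounded_mulL2E G (bq n.+1); have h2 := bounded_mulL2E G (bq n).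
  have h3 := bounded_mulL2E G bb2.
  have h4 := bounded_mulL2E (mulL2 (sqrt_iter b n) G) (bq n).
  pose H := mulL2 (fun x => b x ^+ 2) G
    - mulL2 (sqrt_iter b n) (mulL2 (sqrt_iter b n) G).
  have h5 := L2subE (mulL2 (fun x => b x ^+ 2) G)
    (mulL2 (sqrt_iter b n) (mulL2 (sqrt_iter b n) G)).
  have h6 := L2scaleE 2^-1%:C H.
  have h7 := L2addE (2^-1%:C *: H) (mulL2 (sqrt_iter b n) G).
  apply: filterS (filterI h1 (filterI h2 (filterI h3 (filterI h4 (filterI h5
    (filterI h6 h7)))))).
  move=> x [-> [e2 [e3 [e4 [e5 [e6 e7]]]]]].
  rewrite e7 e6 e5 e4 e3 e2; move: (G x) => [a c] /=.
  by apply/eqP; rewrite eq_complex /=; apply/andP; split; apply/eqP; field.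
have Bq n G : B (mulL2 (sqrt_iter b n) G) = mulL2 (sqrt_iter b n) (B G).
  elim: n G => [|n IH] G.
    have q0 (H : L2) : mulL2 (sqrt_iter b 0) H = 0.
      apply/L2P; have h1 := bounded_mulL2E H (bq 0%N); have h2 := L20E mu.
      apply: filterS (filterI h1 h2) => x [-> ->].
      by rewrite /= mul0r.
    by rewrite !q0; have := lBB 0 0; rewrite !subrr.
  by rewrite !qS lB lBB Bb2 !IH.
set Z1 := B (mulL2 b F); set Z2 := mulL2 b (B F).
pose Z := Z1 - Z2; apply/eqP; rewrite -subr_eq0 -/Z; apply/eqP/normsq_eq0.
apply/eqP; rewrite eq_le normsq_ge0 andbT.
pose K := (normsq F + normsq (B Z)) + (normsq (B F) + normsq Z).
have K0 : 0 <= K by rewrite !addr_ge0// normsq_ge0.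
(* replacing b by the error e in the commutator does not change it *)
have step n : normsq Z <= 2 / n.+2%:R * K.
  pose e x := b x - sqrt_iter b n x.
  have me : measurable_fun setT e by exact: measurable_funB.
  have c0 : 0 < 2 / n.+2%:R :> R by rewrite divr_gt0// ltr0n.
  have ec x : `|e x| <= 2 / n.+2%:R.
    have [/andP[q0 qb] h] := sqrt_iter_bounds n (b01 x).
    by rewrite ger0_norm// /e subr_ge0.
  have be : bounded_mult e by split => //; exists (2 / n.+2%:R).
  have eE G : mulL2 e G = mulL2 b G - mulL2 (sqrt_iter b n) G.
    apply/L2P; apply: filterS (filterI (bounded_mulL2E G be)
      (filterI (bounded_mulL2E G bb) (filterI (bounded_mulL2E G (bq n))
      (L2subE (mulL2 b G) (mulL2 (sqrt_iter b n) G))))) => x [-> [e1 [e2 ->]]].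
    by rewrite e1 e2 /e rmorphB mulrBl.
  have -> : normsq Z = complex.Re (L2dot mu (mulL2 e F) (B Z))
                     - complex.Re (L2dot mu (mulL2 e (B F)) Z).
    have -> : L2dot mu (mulL2 e F) (B Z) = L2dot mu (B (mulL2 e F)) Z.
      exact: esym (sB _ _).
    rewrite -raddfB -L2dotBl; congr (complex.Re (L2dot mu _ Z)).
    by rewrite !eE lBB Bq opprB addrA subrK.
  have := Re_dot_mulL2_le F (B Z) me c0 ec.
  have := Re_dot_mulL2_le (B F) Z me c0 ec.
  rewrite !ler_norml /K; move: (2 / n.+2%:R) => c.
  move: (complex.Re (L2dot mu _ _)) (complex.Re (L2dot mu _ _)) => s t.
  move: (normsq F) (normsq _) (normsq _) (normsq Z) => ? ? ? ?.
  by move=> /andP[? ?] /andP[? ?]; lra.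
rewrite leNgt; apply/negP => Z0.
have [n nK] : exists n : nat, 2 * K / normsq Z < n%:R.
  by exists (Num.bound (2 * K / normsq Z)); apply: archi_boundP;
    rewrite divr_ge0// ?mulr_ge0// ltW.
have := step n; apply/negP; rewrite -ltNge.
rewrite mulrAC ltr_pdivrMr ?ltr0n// -ltr_pdivrMl// mulrC.
by apply: lt_le_trans nK _; rewrite ler_nat ltnW// ltnW.
Qed.

End square_root.

(** * Selfadjointness and square roots of multiplication operators *)

Lemma graph_sub (R : realType) (U V : lmodType R[i]) (T : operator U V) u v u' v' :
  (forall (a : R[i]) p q, T p -> T q -> T (a *: p + q)) ->
  T (u, v) -> T (u', v') -> T (u - u', v - v').
Proof.
move=> lin Tu Tu'.
have -> : (u - u', v - v') = (-1) *: ((u', v') : U * V) + (u, v).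
  by congr pair; rewrite -?[RHS]/((-1) *: u' + u) -?[RHS]/((-1) *: v' + v)
    scaleN1r addrC.
exact: lin.
Qed.

Section adjoints.
Context (R : realType) (U V : lmodType R[i]).
Variables (dU : {dot U for Num.conj}) (dV : {dot V for Num.conj}).

Lemma adjoint_sub (T : operator U V) u v u' v' :
  adjoint dU dV T (v, u) -> adjoint dU dV T (v', u') ->
  adjoint dU dV T (v - v', u - u').
Proof.
move=> Tp Tq a b Tab; have /= := Tp _ _ Tab; have /= := Tq _ _ Tab.
by rewrite !linearBr /= => -> ->.
Qed.

End adjoints.

Section measurability.
Context d (X : measurableType d) (R : realType).
Implicit Type u : X -> R.

Lemma measurable_funV u : measurable_fun setT u -> (forall x, 0 <= u x) ->
  measurable_fun setT (fun x => (u x)^-1).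
Proof.
move=> mu_ u0; rewrite (_ : (fun _ => _) = (fun x => u x `^ (-1))).
  exact: (measurableT_comp (measurable_powR _)).
by apply/funext => x; rewrite powR_inv1.
Qed.

Lemma measurable_fun_sqrt u : measurable_fun setT u ->
  measurable_fun setT (fun x => Num.sqrt (u x)).
Proof.
apply: measurableT_comp; apply: continuous_measurable_fun.
exact: sqrt_continuous.
Qed.

End measurability.

Section positive_multipliers.
Context d (X : measurableType d) (R : realType).
Variable mu : {measure set X -> \bar R}.
Local Notation L2 := (@L2 d X R mu).
Local Notation dot := (L2dot mu).
Implicit Types (F G : L2) (u : X -> R).

Lemma dot_mul_sqrt u F G : (forall x, 0 <= u x) ->
  square_integrable mu (fun x => (Num.sqrt (u x))%:C * F x) ->
  (\forall x \ae mu, G x = (u x)%:C * F x) ->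
  dot G F = dot (mulL2 (fun x => Num.sqrt (u x)) F) (mulL2 (fun x => Num.sqrt (u x)) F).
Proof.
move=> u0 s2 GE; apply: eq_L2dot; apply: filterS (filterI GE (mulL2E s2)).
move=> x [-> ->]; set s := Num.sqrt (u x).
have -> : u x = s * s by rewrite -expr2 sqr_sqrtr.
move: (F x) => [a b].
by apply/eqP; rewrite eq_complex /=; apply/andP; split; apply/eqP; ring.
Qed.

Lemma bounded_mult_sqrt u : bounded_mult u ->
  bounded_mult (fun x => Num.sqrt (u x)).
Proof.
move=> [mu_ [M uM]]; split; first exact: measurable_fun_sqrt.
exists (Num.sqrt M) => x; rewrite ger0_norm ?sqrtr_ge0// ler_wsqrtr//.
by rewrite (le_trans (ler_norm _)).
Qed.

Lemma mulL2_positive u F : bounded_mult u -> (forall x, 0 <= u x) ->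
  0 <= dot (mulL2 u F) F /\ (dot (mulL2 u F) F = 0 -> mulL2 u F = 0).
Proof.
move=> bu u0; have bs := bounded_mult_sqrt bu.
rewrite (dot_mul_sqrt u0 (bounded_mult_sqint F bs) (bounded_mulL2E F bu)).
set sF := mulL2 _ F; split; first exact: (dnorm_ge0 dot).
move=> /eqP; rewrite (dnorm_eq0 dot) => /eqP sF0.
have h : \forall x \ae mu, sF x = 0 by rewrite sF0; exact: L20E.
apply/L2P; apply: filterS (filterI h (filterI (L20E mu) (filterI
  (bounded_mulL2E F bu) (bounded_mulL2E F bs)))) => x [h1 [-> [-> h2]]].
have -> : u x = Num.sqrt (u x) * Num.sqrt (u x) by rewrite -expr2 sqr_sqrtr.
by rewrite rmorphM -mulrA -h2 -/sF h1 mulr0.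
Qed.

End positive_multipliers.

Section square_root_unique.
Context d (X : measurableType d) (R : realType).
Variable mu : {measure set X -> \bar R}.
Local Notation L2 := (@L2 d X R mu).
Local Notation dot := (L2dot mu).
Implicit Types (F G : L2) (S : operator L2 L2).
Variable (g : X -> R).
Hypotheses (mg : measurable_fun setT g) (g0 : forall x, 0 <= g x).

(** The multiplier of (1 + M_g^2)^-1, with M_g multiplication by g. *)
Definition resolvent x := (1 + g x ^+ 2)^-1.

Let den0 x : 0 < 1 + g x ^+ 2.
Proof. by rewrite ltr_pwDl// sqr_ge0. Qed.

Lemma resolvent_gt0 x : 0 < resolvent x. Proof. by rewrite invr_gt0. Qed.

Lemma resolventE x : resolvent x + g x ^+ 2 * resolvent x = 1.
Proof. by rewrite -{1}[resolvent x]mul1r -mulrDl divff// gt_eqF. Qed.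

Lemma measurable_resolvent : measurable_fun setT resolvent.
Proof.
apply: measurable_funV; last by move=> x; rewrite ltW.
by apply: measurable_funD; [exact: measurable_cst|exact: measurable_funX].
Qed.

Lemma bounded_mult_resolvent : bounded_mult resolvent.
Proof.
split; first exact: measurable_resolvent.
exists 1 => x; rewrite ger0_norm ?(ltW (resolvent_gt0 x))//.
by have := resolventE x; have := mulr_ge0 (sqr_ge0 (g x)) (ltW (resolvent_gt0 x)); lra.
Qed.

Lemma mul_resolvent_bounds x : 0 <= g x * resolvent x <= 1.
Proof.
apply/andP; split; first exact: mulr_ge0 (g0 x) (ltW (resolvent_gt0 x)).
rewrite /resolvent ler_pdivrMr// mul1r.
by have := sqr_ge0 (g x - 1); have := sqr_ge0 (g x); rewrite !expr2; nra.
Qed.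

Lemma bounded_mult_mul_resolvent : bounded_mult (fun x => g x * resolvent x).
Proof.
split; first by apply: measurable_funM => //; exact: measurable_resolvent.
by exists 1 => x; have /andP[? ?] := mul_resolvent_bounds x; rewrite ger0_norm.
Qed.

Lemma bounded_mult_sqr_mul_resolvent : bounded_mult (fun x => g x ^+ 2 * resolvent x).
Proof.
split.
  by apply: measurable_funM; [exact: measurable_funX|exact: measurable_resolvent].
exists 1 => x; have := resolventE x; have := resolvent_gt0 x => ? ?.
by have := mulr_ge0 (sqr_ge0 (g x)) (ltW (resolvent_gt0 x)) => ?; rewrite ger0_norm//; lra.
Qed.

Lemma resolvent_decomp F : F = mulL2 resolvent F + mulL2 (fun x => g x ^+ 2 * resolvent x) F.
Proof.
apply/L2P; have h1 := bounded_mulL2E F bounded_mult_resolvent.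
have h2 := bounded_mulL2E F bounded_mult_sqr_mul_resolvent.
apply: filterS (filterI h1 (filterI h2 (L2addE (mulL2 resolvent F)
  (mulL2 (fun x => g x ^+ 2 * resolvent x) F)))) => x [e1 [e2 ->]].
by rewrite e1 e2 -mulrDl -rmorphD /= resolventE mul1r.
Qed.

Local Notation Mg := (mul_op mu (fun x => (g x)%:C)).

(** The range of multiplication by r = 1 / (1 + g^2) lies in the domain of M_g;
    testing the adjoint relation there involves only bounded multipliers and
    gives r g y = r z for every pair (y, z) of the adjoint. *)
Lemma adjoint_mul_op : adjoint dot dot Mg = Mg.
Proof.
apply/seteqP; split => -[y' z'] /=; pose y : L2 := y'; pose z : L2 := z';
  rewrite -[y']/y -[z']/z; last first.
  move=> yz u v /= uv; apply: eq_L2dot; apply: filterS (filterI yz uv) => x /= [-> ->].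
  move: (L2fct u x) (L2fct y x) => [a b] [c e].
  by apply/eqP; rewrite eq_complex /=; apply/andP; split; apply/eqP; ring.
move=> adj.
pose r := resolvent; pose gr x := g x * resolvent x.
have br : bounded_mult r := bounded_mult_resolvent.
have bgr : bounded_mult gr := bounded_mult_mul_resolvent.
have eqr : mulL2 gr y = mulL2 r z.
  apply: (@dot_nondeg _ _ dot) => w.
  have h : Mg (mulL2 r w, mulL2 gr w).
    rewrite /mul_op /=.
    apply: filterS (filterI (bounded_mulL2E w br) (bounded_mulL2E w bgr)).
    by move=> x [-> ->]; rewrite mulrA -rmorphM.
  have := adj _ _ h => /= {}h.
  have : dot w (mulL2 gr y) = dot w (mulL2 r z) by rewrite -!mulL2_sym.
  by move=> e; rewrite [LHS]hermC [RHS]hermC /= e.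
have h3 : \forall x \ae mu, mulL2 gr y x = mulL2 r z x by rewrite eqr; exact: aeW.
apply: filterS (filterI (bounded_mulL2E y bgr) (filterI (bounded_mulL2E z br) h3)).
move=> x [e1 [e2 h]] /=; rewrite e1 e2 in h; have r0 : (resolvent x)%:C != 0 :> R[i].
  by rewrite fmorph_eq0 gt_eqF// resolvent_gt0.
apply: (mulfI r0); rewrite -h /gr mulrA; congr (_ * _).
by rewrite -rmorphM mulrC.
Qed.

Lemma mul_op_dense : densely_defined dot Mg.
Proof.
move=> F0 e e0; pose F : L2 := F0; rewrite -[F0]/F; pose E n := g @^-1` `]-oo, n%:R].
have mE n : measurable (E n).
  by rewrite -[E n]setTI; exact: mg.
have hE : \forall x \ae mu, F x != 0 -> \forall n \near \oo, E n x.
  apply: nearW => x _; exists (Num.bound (g x)) => // n /= hn; rewrite /E /= ?in_itv /=.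
  apply: ltW; apply: lt_le_trans (archi_boundP (g0 x)) _; by rewrite ler_nat.
have [n hn] := L2_truncation mE hE e0; exists (mulL2 \1_(E n) F) => //.
have b1 := bounded_mult_indic R (mE n).
have b2 : bounded_mult (fun x => g x * \1_(E n) x).
  split; first by apply: measurable_funM => //; exact: measurable_indic.
  exists n%:R => x; rewrite indicE; have [xE|xE] := boolP (x \in E n).
    by rewrite mulr1 ger0_norm//; move: xE; rewrite inE /E /= ?in_itv.
  by rewrite mulr0 normr0.
exists (mulL2 (fun x => g x * \1_(E n) x) F).
apply: filterS (filterI (bounded_mulL2E F b1) (bounded_mulL2E F b2)).
by move=> x /= [-> ->]; rewrite mulrA -rmorphM.
Qed.

(** If y and z = g^2 y are square-integrable then so is g y, which is
    g / (1 + g^2) times y + z. *)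
Lemma comp_mul_op : comp_op Mg Mg = mul_op mu (fun x => (g x ^+ 2)%:C).
Proof.
apply/seteqP; split => -[y' z'] /=; pose y : L2 := y'; pose z : L2 := z';
  rewrite -[y']/y -[z']/z.
  move=> [v [yv vz]]; apply: filterS (filterI yv vz) => x /= [-> ->].
  by rewrite mulrA -rmorphM.
move=> yz; exists (mulL2 (fun x => g x * resolvent x) (y + z)).
have h1 := bounded_mulL2E (y + z) bounded_mult_mul_resolvent.
have h : \forall x \ae mu, mulL2 (fun x => g x * resolvent x) (y + z) x = (g x)%:C * y x.
  apply: filterS (filterI yz (filterI h1 (L2addE y z))) => x /= [e1 [-> ->]].
  have -> : y x + z x = (1 + g x ^+ 2)%:C * y x.
    by rewrite e1 rmorphD mulrDl mul1r.
  rewrite mulrA -rmorphM; congr (_%:C * _).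
  by rewrite -mulrA mulVf ?mulr1// gt_eqF.
split; first exact: h.
apply: filterS (filterI h yz) => x /= [-> ->].
by rewrite mulrA -rmorphM.
Qed.

Lemma mul_op_positive : positive_op dot Mg.
Proof.
move=> u' v' /=; pose u : L2 := u'; pose v : L2 := v'; rewrite -[u']/u -[v']/v => uv.
have s2 : square_integrable mu (fun x => (Num.sqrt (g x))%:C * u x).
  apply/square_integrableM; [exact: measurable_fun_sqrt|exact: L2_measurable|].
  have m1 : measurable_fun setT (cst 1%E : X -> \bar R) by exact: measurable_cst.
  have := qform1 (u + v); have mo := L2_measurable (u + v).
  set N := complex.Re _ => qN; apply: (@le_lt_trans _ _ N%:E); last by rewrite ltry.
  rewrite -qN.
  have -> : qform mu (cst 1%E) (u + v : L2) = qform mu (fun x => ((1 + g x) ^+ 2)%:E) u.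
    apply: ae_eq_qform => //; do ?exact: L2_measurable.
      apply/measurable_EFinP; apply: measurable_funX; apply: measurable_funD => //.
    apply: filterS (filterI uv (L2addE u v)) => x /= [e1 ->]; rewrite e1 mul1e.
    have -> : u x + (g x)%:C * u x = (1 + g x)%:C * u x.
      by rewrite rmorphD mulrDl mul1r.
    by rewrite sqmodR EFinM.
  apply: le_qform => //.
  - by apply/measurable_EFinP; apply: measurable_funX; exact: measurable_fun_sqrt.
  - by apply/measurable_EFinP; apply: measurable_funX; exact: measurable_funD.
  - exact: L2_measurable.
  - by move=> x; rewrite lee_fin sqr_ge0.
  - apply: nearW => x; rewrite lee_fin sqr_sqrtr//.
    by move: (g x) (g0 x) => a; nra.
by rewrite [X in 0 <= X](dot_mul_sqrt g0 s2 uv) (dnorm_ge0 dot).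
Qed.

Lemma mul_op_selfadjoint : selfadjoint dot Mg.
Proof. by split; [exact: mul_op_dense|exact: adjoint_mul_op]. Qed.

(** With r = 1 / (1 + g^2), the map B = S M_r is everywhere defined, because the
    range of M_r is the domain of S S.  It is symmetric and positive, and has the
    same square as multiplication by g r; hence B is multiplication by g r.  Since
    S commutes with M_r, every (u, v) in S satisfies r v = S (r u) = g r u, so S
    is contained in M_g.  Both being selfadjoint, taking adjoints reverses the
    inclusion. *)
Lemma sqrt_mul_op_unique S : adjoint dot dot S = S -> positive_op dot S ->
  comp_op S S = mul_op mu (fun x => (g x ^+ 2)%:C) -> S = Mg.
Proof.
move=> SA S0 SS.
have symS u v u' v' : S (u, v) -> S (u', v') -> dot v u' = dot u v'.
  by move=> Suv; rewrite -{1}SA => /(_ _ _ Suv).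
have subS u v u' v' : S (u, v) -> S (u', v') -> S (u - u', v - v').
  by rewrite -SA => Su Sv; exact: adjoint_sub.
pose r := resolvent; pose g2r x := g x ^+ 2 * resolvent x; pose b x := g x * resolvent x.
have br : bounded_mult r := bounded_mult_resolvent.
have bg2r : bounded_mult g2r := bounded_mult_sqr_mul_resolvent.
have bb : bounded_mult b := bounded_mult_mul_resolvent.
have decomp F : F = mulL2 r F + mulL2 g2r F := resolvent_decomp F.
have chain F : exists a, S (mulL2 r F, a) /\ S (a, mulL2 g2r F).
  have : mul_op mu (fun x => (g x ^+ 2)%:C) (mulL2 r F, mulL2 g2r F).
    apply: filterS (filterI (bounded_mulL2E F br) (bounded_mulL2E F bg2r)).
    by move=> x /= [-> ->]; rewrite mulrA -rmorphM.
  by rewrite -SS.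
have [B hB] := choice chain.
(* S commutes with multiplication by r: if a = S (r F) then
   c - a = S (F - r F) = S (g^2 r F) = S S a = g^2 a, so that a = r c *)
have comm F c a : S (F, c) -> S (mulL2 r F, a) -> S (a, mulL2 g2r F) ->
    a = mulL2 r c.
  move=> SF Sr Sa; have e : mulL2 g2r F = F - mulL2 r F.
    by rewrite [X in _ = X - _]decomp addrC addKr.
  have : comp_op S S (a, c - a).
    by exists (mulL2 g2r F); split => //; rewrite e; exact: subS.
  rewrite SS => h; apply/L2P.
  apply: filterS (filterI h (filterI (L2subE c a) (bounded_mulL2E c br))).
  move=> x /= [h1 [h2 ->]]; move: h1; rewrite h2 => /eqP; rewrite subr_eq => /eqP ->.
  have -> : (g x ^+ 2)%:C * a x + a x = (1 + g x ^+ 2)%:C * a x.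
    by rewrite [RHS]mulrC rmorphD mulrDr mulr1 addrC [_ * a x]mulrC.
  by rewrite mulrA -rmorphM mulVf ?rmorph1 ?mul1r// gt_eqF.
have sB : symmetric_map dot B.
  move=> F G; have [F1 F2] := hB F; have [G1 G2] := hB G.
  rewrite [in LHS](decomp G) [in RHS](decomp F) linearDr linearDl /=.
  by rewrite (symS _ _ _ _ F1 G1) (symS _ _ _ _ F2 G2).
have B0 F : 0 <= dot (B F) F.
  have [F1 F2] := hB F.
  have -> : dot (B F) F = dot (B F) (mulL2 r F) + dot (B F) (mulL2 g2r F).
    by rewrite -[RHS](linearDr dot) -decomp.
  have := S0 _ _ F1; have : 0 <= dot (B F) (mulL2 g2r F).
    have -> : dot (B F) (mulL2 g2r F) = Num.conj (dot (mulL2 g2r F) (B F)).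
      by have := L2dot_herm (B F) (mulL2 g2r F); rewrite expr0 mul1r.
    by rewrite conjC_ge0; exact: S0 _ _ F2.
  by move=> h2 h1; exact: addr_ge0 h1 h2.
have BB F : B (B F) = mulL2 r (mulL2 g2r F).
  have [F1 F2] := hB F; have [G1 G2] := hB (B F); exact: comm G1 G2.
have BBb F : B (B F) = mulL2 (fun x => b x ^+ 2) F.
  rewrite BB; apply/L2P; have bb2 : bounded_mult (fun x => b x ^+ 2).
    exact: bounded_multM.
  apply: filterS (filterI (bounded_mulL2E F bg2r) (filterI
    (bounded_mulL2E (mulL2 g2r F) br) (bounded_mulL2E F bb2))).
  move=> x [e [-> ->]]; rewrite e mulrA -rmorphM; congr (_%:C * _).
  by rewrite /r /g2r /b; ring.
have bbF F : mulL2 b (mulL2 b F) = mulL2 (fun x => b x ^+ 2) F.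
  apply/L2P; have bb2 : bounded_mult (fun x => b x ^+ 2) by exact: bounded_multM.
  apply: filterS (filterI (bounded_mulL2E F bb) (filterI
    (bounded_mulL2E (mulL2 b F) bb) (bounded_mulL2E F bb2))).
  by move=> x [e [-> ->]]; rewrite e mulrA -rmorphM.
have b01 x : 0 <= b x <= 1 := mul_resolvent_bounds x.
have Bb : forall F, B (mulL2 b F) = mulL2 b (B F).
  apply: commute_mulL2_sqrt => //; first by case: bb.
  by move=> F; rewrite -!BBb.
have bpos F := mulL2_positive F bb (fun x => (andP (b01 x)).1).
have BBbb F : B (B F) = mulL2 b (mulL2 b F) by rewrite BBb bbF.
have sb : symmetric_map dot (mulL2 b : L2 -> L2) by move=> F G; exact: mulL2_sym.
have BE : forall F, B F = mulL2 b F :=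
  commuting_sqrt_unique sB sb B0 (fun F => (bpos F).1) (fun F => (bpos F).2) BBbb Bb.
have SMg : S `<=` Mg.
  move=> [u v] Suv; have [h1 h2] := hB u.
  have e : mulL2 b u = mulL2 r v by rewrite -BE; exact: comm Suv h1 h2.
  have h3 : \forall x \ae mu, mulL2 b u x = mulL2 r v x by rewrite e; exact: aeW.
  apply: filterS (filterI (bounded_mulL2E u bb) (filterI (bounded_mulL2E v br) h3)).
  move=> x [e1 [e2 h]] /=; rewrite e1 e2 in h; have r0 : (resolvent x)%:C != 0 :> R[i].
    by rewrite fmorph_eq0 gt_eqF// resolvent_gt0.
  apply: (mulfI r0); rewrite -h /b mulrA; congr (_ * _).
  by rewrite -rmorphM mulrC.
apply/seteqP; split => // p; rewrite -SA -{1}adjoint_mul_op => Mp u v Suv.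
by apply: Mp; exact: SMg.
Qed.

Lemma sqrt_op_mul_op : sqrt_op dot (comp_op Mg Mg) = Mg.
Proof.
apply: xget_unique.
  split; [exact: mul_op_selfadjoint|exact: mul_op_positive|by []].
by move=> S [[_ SA] S0 SS]; apply: sqrt_mul_op_unique => //; rewrite SS comp_mul_op.
Qed.

End square_root_unique.

(** * Change of variables for weighted compositions *)

Section change_of_variables.
Local Open Scope ereal_scope.
Context d (X : measurableType d) (R : realType).
Variable mu : {measure set X -> \bar R}.
Implicit Types (psi : X -> X) (w k : X -> \bar R).

Import HBNNSimple.

Lemma integral_comp_sfun psi w (f : {nnsfun X >-> R}) :
  measurable_fun setT psi -> measurable_fun setT w -> (forall x, 0 <= w x) ->
  \int[mu]_x ((f (psi x))%:E * w x) =
  \sum_(y \in range f) y%:E * \int[mu]_(x in psi @^-1` (f @^-1` [set y])) w x.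
Proof.
move=> mpsi mw w0.
have mA y : measurable (psi @^-1` (f @^-1` [set y])).
  by rewrite -[_ @^-1` _]setTI; exact: mpsi.
have mi y : measurable_fun setT
    (fun x => (y * \1_(psi @^-1` (f @^-1` [set y])) x)%:E * w x).
  apply: emeasurable_funM => //; apply/measurable_EFinP.
  by apply: measurable_funM; [exact: measurable_cst|exact: measurable_indic].
have i0 y x : 0 <= (y * \1_(f @^-1` [set y]) x)%:E by exact: nnfun_muleindic_ge0.
transitivity (\int[mu]_x (\sum_(y \in range f)
    ((y * \1_(psi @^-1` (f @^-1` [set y])) x)%:E * w x))).
  apply: eq_integral => x _; rewrite -ge0_mule_fsuml; last first.
    by move=> y; exact: (i0 y (psi x)).
  by rewrite fsumEFin// -(fimfunE f (psi x)).
rewrite ge0_integral_fsum//; last first.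
  by move=> y x _; rewrite mule_ge0// (i0 y (psi x)).
apply: eq_fsbigr => y /[!inE] -[z _ <-].
rewrite [in RHS]integral_mkcond.
under eq_integral do rewrite EFinM -muleA.
rewrite ge0_integralZl//; last 3 first.
- apply: emeasurable_funM => //; apply/measurable_EFinP.
  exact: measurable_indic.
- by move=> x _; rewrite mule_ge0// lee_fin.
- by rewrite lee_fin.
congr (_ * _); apply: eq_integral => x _.
by rewrite muleC epatch_indic.
Qed.

(** Where w is infinite, multiplication by w is discontinuous at 0, but the
    approximations of k vanish with k and are eventually positive where k is. *)
Lemma integral_comp_lim psi w k : measurable_fun setT psi ->
  measurable_fun setT w -> (forall x, 0 <= w x) ->
  forall mk : measurable_fun setT k, (forall x, 0 <= k x) ->
  \int[mu]_x (k (psi x) * w x) =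
  limn (fun n => \int[mu]_x ((nnsfun_approx measurableT mk n (psi x))%:E * w x)).
Proof.
move=> mpsi mw w0 mk k0; set f := nnsfun_approx measurableT mk.
rewrite -monotone_convergence//.
- apply: eq_integral => x _; apply/esym/cvg_lim => //.
  have fk : (f n (psi x))%:E @[n --> \oo] --> k (psi x).
    by apply: cvg_nnsfun_approx => // y _; exact: k0.
  have [wy|wx] := eqVneq (w x) +oo; last first.
    by apply: cvgeZr => //; rewrite ge0_fin_numE// ltey.
  rewrite wy; have [k00|k00] := eqVneq (k (psi x)) 0.
    rewrite k00 mul0e; apply: cvg_near_cst; apply: nearW => n.
    suff -> : (f n (psi x) = 0)%R by rewrite mul0e.
    apply/eqP; rewrite eq_le fun_ge0 andbT -lee_fin.
    have /ereal_nondecreasing_cvgn fsup :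
        nondecreasing_seq (fun n => (f n (psi x))%:E).
      by move=> i j ij; rewrite lee_fin; exact/lefP/nd_nnsfun_approx.
    have e0 : ereal_sup (range (fun n => (f n (psi x))%:E)) = 0.
      by rewrite -k00; exact: cvg_unique fsup fk.
    by rewrite -[leRHS]e0; apply: ereal_sup_ubound; exists n.
  have kp : 0 < k (psi x) by rewrite lt0e k00 k0.
  rewrite gt0_muley//; apply: cvg_near_cst.
  have : \forall n \near \oo, 0 < (f n (psi x))%:E.
    apply: (fk [set y | 0 < y]); apply: open_nbhs_nbhs; split => //.
    exact: open_ereal_gt_ereal.
  by apply: filterS => n h; rewrite gt0_muley.
- move=> n; apply: emeasurable_funM => //; apply/measurable_EFinP.
  exact: measurableT_comp.
- by move=> n x _; rewrite mule_ge0// lee_fin.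
- move=> x _ m n mn; rewrite lee_wpmul2r// lee_fin; exact/lefP/nd_nnsfun_approx.
Qed.

(** Both sides are monotone limits of integrals of simple functions, and agree
    on these by the definition of the density of an image measure. *)
Lemma wco_density_integral phi omega h k :
  wco_symbol mu phi omega -> wco_density mu phi omega h ->
  measurable_fun setT k -> (forall x, 0 <= k x) ->
  \int[mu]_x (k (phi x) * (sqmod (omega x))%:E) = \int[mu]_x (k x * h x).
Proof.
move=> [mphi mom _] [mh h0 hE] mk k0.
have mw := measurable_sqmod mom.
have w0 x : 0 <= (sqmod (omega x))%:E by rewrite lee_fin sqmod_ge0.
have mid : measurable_fun setT (id : X -> X) by exact: measurable_id.
rewrite (integral_comp_lim mphi mw w0 mk k0) (integral_comp_lim mid mh h0 mk k0).
congr (limn _); apply/funext => n.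
rewrite (integral_comp_sfun _ mphi mw w0) (integral_comp_sfun _ mid mh h0).
apply: eq_fsbigr => y _; congr (_ * _).
exact: hE.
Qed.

(** Makes the relation defining a weighted composition operator independent of
    the representatives, since almost everywhere statements can be pulled back
    along phi off the zeros of omega. *)
Lemma wco_symbol_ae phi omega (P : X -> Prop) : wco_symbol mu phi omega ->
  (\forall x \ae mu, P x) -> \forall x \ae mu, omega x != 0%R -> P (phi x).
Proof.
move=> [mphi mom /null_content_dominatesP dom] [N [mN N0 PN]].
have mphiN : measurable (phi @^-1` N) by rewrite -[_ @^-1` _]setTI; exact: mphi.
have : \int[mu]_(x in phi @^-1` N) `|(sqmod (omega x))%:E| = 0.
  rewrite -[RHS](dom N mN N0) /image_wmeasure /wmeasure.
  by apply: eq_integral => x _; rewrite gee0_abs// lee_fin sqmod_ge0.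
have mw := measurable_funTS (measurable_sqmod mom).
move=> /(ae_eq_integral_abs mu mphiN (mw _)).1.
apply: filterS => x h om0; apply: contrapT => nP.
have /h[/eqP] : (phi @^-1` N) x by apply: PN.
by rewrite sqmod_eq0 (negbTE om0).
Qed.

End change_of_variables.

(** * Operators determined by a weight and their absolute values *)

Section polarization.
Context (R : realType) (V : lmodType R[i]) (dV : {dot V for Num.conj}).
Implicit Types y z : V.

Lemma Re_dot_add y z : complex.Re (dV (y + z) (y + z)) =
  complex.Re (dV y y) + complex.Re (dV z z) + 2 * complex.Re (dV y z).
Proof.
rewrite dnormD /=; move: (dV y y) (dV z z) (dV y z) => [a a'] [b b'] [c c'] /=.
by ring.
Qed.

Lemma Re_dot_scale (a : R[i]) y :
  complex.Re (dV (a *: y) (a *: y)) = sqmod a * complex.Re (dV y y).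
Proof.
rewrite linearZl_LR linearZr_LR /=.
have : complex.Im (dV y y) = 0.
  by have := dnorm_ge0 dV y; rewrite lecE /= => /andP[/eqP].
move: a (dV y y) => [a a'] [b b'] /= ->; rewrite /sqmod /=; ring.
Qed.

Lemma Re_dot_ge0 y : 0 <= complex.Re (dV y y).
Proof. by have := dnorm_ge0 dV y; rewrite lecE /= => /andP[]. Qed.

Lemma Re_dot_eq0 y : complex.Re (dV y y) = 0 -> y = 0.
Proof.
move=> h; apply/eqP; rewrite -(dnorm_eq0 dV) eq_complex h eqxx /=.
by have := dnorm_ge0 dV y; rewrite lecE /= => /andP[].
Qed.

End polarization.

Section quadratic_forms.
Context d (X : measurableType d) (R : realType).
Variable mu : {measure set X -> \bar R}.
Local Notation L2 := (@L2 d X R mu).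
Local Notation dot := (L2dot mu).
Implicit Types (F G : L2) (k : X -> \bar R).

(** T is, up to an isometry of its range, multiplication by the square root
    of k. *)
Definition has_form (V : lmodType R[i]) (dV : {dot V for Num.conj})
    (T : operator L2 V) k :=
  [/\ forall (a : R[i]) p q, T p -> T q -> T (a *: p + q),
      forall F, dom T F <-> (qform mu k F < +oo)%E
    & forall F v, T (F, v) -> (complex.Re (dV v v))%:E = qform mu k F].

Section one_operator.
Context (V : lmodType R[i]) (dV : {dot V for Num.conj}).
Implicit Types (T : operator L2 V).

Lemma qform_0 k : measurable_fun setT k -> qform mu k (0 : L2) = 0%E.
Proof.
move=> mk; rewrite /qform (ae_eq_integral (cst 0%E)) ?integral0//.
- exact/measurable_qform/L2_measurable.
- apply: filterS (L20E mu) => x -> _.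
  have -> : sqmod (0 : R[i]) = 0 by apply/eqP; rewrite sqmod_eq0.
  by rewrite mule0.
Qed.

Lemma has_form_sub T k F G v w : has_form dV T k ->
  T (F, v) -> T (G, w) -> T (F - G, v - w).
Proof.
by move=> [lin _ _]; exact: graph_sub.
Qed.

Lemma has_form_functional T k F v w : has_form dV T k ->
  T (F, v) -> T (F, w) -> v = w.
Proof.
move=> Tk TF TG; have T0 := has_form_sub Tk TF TF; have Tvw := has_form_sub Tk TF TG.
move: Tk => [_ _ Tn]; apply/eqP; rewrite -subr_eq0; apply/eqP/(@Re_dot_eq0 _ _ dV).
move: T0 Tvw; rewrite !subrr => T0 Tvw.
by have := Tn _ _ T0; rewrite -(Tn _ _ Tvw) linear0l => -[].
Qed.

Lemma has_form_linear T k : measurable_fun setT k -> has_form dV T k ->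
  is_linear_op T.
Proof.
move=> mk Tk; have [lin Td _] := Tk; split => //.
- have [|v T0] := (Td 0).2; first by rewrite qform_0 ?ltry.
  by have := has_form_sub Tk T0 T0; rewrite !subrr.
- by move=> u v w; exact: has_form_functional Tk.
Qed.

Lemma ae_eq_has_form T k k' : measurable_fun setT k -> measurable_fun setT k' ->
  (\forall x \ae mu, k x = k' x) -> has_form dV T k -> has_form dV T k'.
Proof.
move=> mk mk' kk' [lin Td Tn].
have e F : qform mu k F = qform mu k' F.
  apply: ae_eq_qform => //; do ?exact: L2_measurable.
  by apply: filterS kk' => x ->.
by split => // [F|F v]; rewrite -e; [exact: Td|exact: Tn].
Qed.

End one_operator.

(** By polarization: the norms of T (a F + G) for a = 1 and a = i determine the
    real and imaginary parts of the inner product of T F and T G. *)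
Lemma has_form_dot (V W : lmodType R[i]) (dV : {dot V for Num.conj})
    (dW : {dot W for Num.conj}) (T : operator L2 V) (T' : operator L2 W) k
    F G v w v' w' : has_form dV T k -> has_form dW T' k ->
  T (F, v) -> T (G, w) -> T' (F, v') -> T' (G, w') -> dV v w = dW v' w'.
Proof.
move=> [lin _ Tn] [lin' _ Tn'] TF TG TF' TG'.
have eqn H u u' : T (H, u) -> T' (H, u') ->
    complex.Re (dV u u) = complex.Re (dW u' u').
  by move=> /Tn e1 /Tn'; rewrite -e1 => -[].
have pol (a : R[i]) : complex.Re (dV (a *: v + w) (a *: v + w)) =
    complex.Re (dW (a *: v' + w') (a *: v' + w')).
  exact: eqn (lin a _ _ TF TG) (lin' a _ _ TF' TG').
have eF := eqn _ _ _ TF TF'; have eG := eqn _ _ _ TG TG'.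
have Re_eq (a : R[i]) : complex.Re (a * dV v w) = complex.Re (a * dW v' w').
  have := pol a; rewrite !Re_dot_add !Re_dot_scale eF eG.
  rewrite ![_ (a *: _) _]linearZl_LR /= => /addrI.
  by apply: mulfI; rewrite pnatr_eq0.
apply/eqP; rewrite eq_complex; apply/andP; split; apply/eqP.
  by have := Re_eq 1; rewrite !mul1r.
have := Re_eq (0 +i* 1); move: (dV v w) (dW v' w') => [a a'] [b b'] /=.
by rewrite !mul0r !mul1r !sub0r => /oppr_inj.
Qed.

Section absolute_value.
Variable k : X -> \bar R.
Hypotheses (mk : measurable_fun setT k) (k0 : forall x, (0 <= k x)%E).
Hypothesis kfin : \forall x \ae mu, (k x < +oo)%E.

Let g x := Num.sqrt (fine (k x)).

Lemma measurable_sqrt_fine : measurable_fun setT g.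
Proof. by apply: measurable_fun_sqrt; exact: measurableT_comp. Qed.

Lemma sqr_sqrt_fine x : (k x < +oo)%E -> (g x ^+ 2)%:E = k x.
Proof.
by move=> kx; rewrite sqr_sqrtr ?fine_ge0// fineK// ge0_fin_numE.
Qed.

Lemma qform_sqrt_fine F :
  qform mu k F = qform mu (fun x => (g x ^+ 2)%:E) F.
Proof.
apply: ae_eq_qform => //; do ?exact: L2_measurable.
- by apply/measurable_EFinP/measurable_funX/measurable_sqrt_fine.
- by apply: filterS kfin => x kx; rewrite sqr_sqrt_fine.
Qed.

Lemma has_form_mul_op : has_form dot (mul_op mu (csqrt k)) k.
Proof.
have mg := measurable_sqrt_fine.
have vE F (v : L2) : mul_op mu (csqrt k) (F, v) -> qform mu (cst 1%E) v = qform mu k F.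
  move=> Fv; rewrite qform_sqrt_fine; apply: ae_eq_qform => //;
    do ?exact: L2_measurable.
  - by apply/measurable_EFinP/measurable_funX.
  - by apply: filterS Fv => x /= ->; rewrite mul1e sqmodR EFinM.
split.
- move=> a [F v] [G w] /= Fv Gw.
  apply: filterS (filterI (filterI Fv Gw) (filterI (filterI (L2scaleE a F)
    (L2addE (a *: F) G)) (filterI (L2scaleE a v) (L2addE (a *: v) w)))).
  move=> x /= [[e1 e2] [[e3 e4] [e5 e6]]].
  by rewrite e6 e5 e4 e3 e1 e2; ring.
- move=> F; split=> [[v /vE <-]|]; first by rewrite qform1 ltry.
  rewrite qform_sqrt_fine => /(square_integrableM mu mg (L2_measurable F)) h.
  by exists (mulL2 g F); exact: mulL2E.
- by move=> F v /vE <-; rewrite qform1.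
Qed.

(** The graph of T^* T is described by the inner products of the values of T,
    hence is the same for T and for multiplication by sqrt k, which is its own
    adjoint. *)
Lemma abs_op_has_form (V : lmodType R[i]) (dV : {dot V for Num.conj})
  (T : operator L2 V) : has_form dV T k -> abs_op dot dV T = mul_op mu (csqrt k).
Proof.
move=> Tk; have Mk := has_form_mul_op; set M := mul_op mu (csqrt k) in Mk *.
have g0 x : 0 <= g x by rewrite sqrtr_ge0.
have Madj : adjoint dot dot M = M := adjoint_mul_op mu measurable_sqrt_fine g0.
rewrite /abs_op; suff -> : comp_op (adjoint dot dV T) T = comp_op M M.
  exact: (sqrt_op_mul_op mu measurable_sqrt_fine g0).
rewrite -[X in comp_op X M]Madj; have [_ Td _] := Tk; have [_ Md _] := Mk.
apply/seteqP; split => -[F w] /= [v [Fv vw]].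
- have [v' Fv'] := (Md F).2 ((Td F).1 (ex_intro _ v Fv)); exists v'; split => //.
  move=> G u' Gu' /=; have [u Gu] := (Td G).2 ((Md G).1 (ex_intro _ u' Gu')).
  rewrite -(vw _ _ Gu) /=; exact: (has_form_dot Mk Tk Gu' Fv' Gu Fv).
- have [v' Fv'] := (Td F).2 ((Md F).1 (ex_intro _ v Fv)); exists v'; split => //.
  move=> G u' Gu' /=; have [u Gu] := (Md G).2 ((Td G).1 (ex_intro _ u' Gu')).
  rewrite -(vw _ _ Gu) /=; exact: (has_form_dot Tk Mk Gu' Fv' Gu Fv).
Qed.

End absolute_value.

Lemma has_form_zero_op : has_form dot (zero_op L2 L2) (cst 0%E).
Proof.
have q0 F : qform mu (cst 0%E) F = 0%E.
  by rewrite /qform; under eq_integral do rewrite mul0e; rewrite integral0.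
split.
- move=> a [F v] [G w]; rewrite /zero_op /= => -> ->.
  by rewrite scaler0 addr0.
- by move=> F; rewrite q0 ltry; split => // _; exists 0.
- move=> F v v0; have {v0} -> : v = 0 := v0.
  by rewrite q0 linear0l.
Qed.

Lemma has_form_column (I : finType) (T : I -> operator L2 L2)
    (k : I -> X -> \bar R) :
  (forall i, measurable_fun setT (k i)) -> (forall i x, 0 <= k i x)%E ->
  (forall i, has_form dot (T i) (k i)) ->
  has_form (sumdot dot) (column_op T) (fun x => \sum_i k i x)%E.
Proof.
move=> mk k0 Tk.
have qE F : qform mu (fun x => \sum_i k i x)%E F = (\sum_i qform mu (k i) F)%E.
  rewrite /qform -ge0_integral_sum//; last 2 first.
  - by move=> i; apply: measurable_qform => //; exact: L2_measurable.
  - by move=> i x _; rewrite mule_ge0// lee_fin sqmod_ge0.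
  by apply: eq_integral => x _; rewrite ge0_sume_distrl.
split.
- move=> a [F v] [G w] Fv Gw i; have [lin _ _] := Tk i.
  by rewrite /= !ffunE; exact: (lin a _ _ (Fv i) (Gw i)).
- move=> F; rewrite qE; split=> [[v Fv]|h].
    apply: lte_sum_pinfty => i _; have [_ Td _] := Tk i.
    by apply/Td; exists (v i); exact: Fv.
  have Td i : exists v, T i (F, v).
    have [_ Td _] := Tk i; apply/(Td F); apply: le_lt_trans h.
    by rewrite (bigD1 i)//= leeDl// sume_ge0// => j _; exact: qform_ge0.
  by have [v Fv] := choice Td; exists [ffun i => v i] => i /=; rewrite ffunE.
- move=> F v Fv; rewrite qE.
  transitivity (\sum_i (complex.Re (dot (v i) (v i)))%:E)%E.
    by rewrite sumEFin; congr EFin; exact: (raddf_sum (@complex.Re R)).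
  by apply: eq_bigr => i _; have [_ _ Tn] := Tk i; exact: Tn (Fv i).
Qed.

Lemma has_form_wco phi omega h : wco_symbol mu phi omega ->
  wco_density mu phi omega h -> has_form dot (wco mu phi omega) h.
Proof.
move=> sym den; have [mphi mom _] := sym; have [mh h0 _] := den.
have mcomp F : cmeasurable (fun x => omega x * F (phi x)).
  apply: cmeasurableM => //; have [mr mi] := L2_measurable F.
  by split; [exact: measurableT_comp mr mphi|exact: measurableT_comp mi mphi].
have qE F : qform mu h F = qform mu (cst 1%E) (fun x => omega x * F (phi x)).
  rewrite /qform.
  under eq_integral do rewrite muleC.
  rewrite -(wco_density_integral sym den); last 2 first.
  - exact/measurable_sqmod/L2_measurable.
  - by move=> x; rewrite lee_fin sqmod_ge0.
  by apply: eq_integral => x _; rewrite mul1e sqmodM EFinM muleC.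
have vE F (v : L2) : wco mu phi omega (F, v) -> qform mu (cst 1%E) v = qform mu h F.
  move=> Fv; rewrite qE; apply: ae_eq_qform => //; do ?exact: measurable_cst.
  - exact: L2_measurable.
  - by apply: filterS Fv => x /= ->.
split.
- move=> a [F v] [G w] /= Fv Gw.
  have h1 : \forall x \ae mu, omega x != 0 ->
      (a *: F : L2) (phi x) = a * F (phi x) /\
      (a *: F + G : L2) (phi x) = (a *: F : L2) (phi x) + G (phi x).
    exact: wco_symbol_ae sym (filterI (L2scaleE a F) (L2addE (a *: F) G)).
  apply: filterS (filterI (filterI Fv Gw) (filterI h1
    (filterI (L2scaleE a v) (L2addE (a *: v) w)))).
  move=> x /= [[e1 e2] [e34 [e5 e6]]].
  rewrite e6 e5 e1 e2; have [-> |om0] := eqVneq (omega x) 0.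
    by rewrite !mul0r mulr0 addr0.
  by have [e3 e4] := e34 om0; rewrite e4 e3; ring.
- move=> F; split=> [[v /vE <-]|]; first by rewrite qform1 ltry.
  rewrite qE => /(square_integrableE mu (mcomp F)) hF.
  by exists (L2of mu (fun x => omega x * F (phi x))); exact: L2ofE.
- by move=> F v /vE <-; rewrite qform1.
Qed.

End quadratic_forms.

(** * Finiteness of the weight and operator norms *)

Section sigma_finite.
Context d (X : measurableType d) (R : realType).
Variable mu : {sigma_finite_measure set X -> \bar R}.
Local Notation L2 := (@L2 d X R mu).
Local Notation dot := (L2dot mu).
Implicit Types (F G : L2) (k : X -> \bar R) (E A : set X).

Lemma exists_finite_positive_subset A : measurable A -> mu A != 0%E ->
  exists E, [/\ measurable E, E `<=` A, (0 < mu E)%E & (mu E < +oo)%E].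
Proof.
move=> mA A0; have [S XS hS] := sigma_finiteT mu.
apply: contrapT => nE; move/eqP: A0; apply.
have AE : A = \bigcup_i (A `&` S i) by rewrite -setI_bigcupr -XS setIT.
rewrite AE; apply/negligibleP; first by apply: bigcup_measurable => i _;
  apply: measurableI => //; exact: (hS i).1.
apply: negligible_bigcup => i; apply/negligibleP.
  by apply: measurableI => //; exact: (hS i).1.
apply/eqP/negPn/negP => m0; apply: nE; exists (A `&` S i); split.
- by apply: measurableI => //; exact: (hS i).1.
- by move=> x [].
- by rewrite lt0e m0 measure_ge0.
- have [mS Sfin] := hS i; apply: le_lt_trans Sfin.
  by apply: le_measure; rewrite ?inE//; exact: measurableI.
Qed.

Definition indicL2 (c : R) E : L2 := L2of mu (fun x => (c * \1_E x)%:C).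

Section indicL2.
Variables (c : R) (E : set X).
Hypotheses (mE : measurable E) (Efin : (mu E < +oo)%E).

Lemma cmeasurable_indic : cmeasurable (fun x => (c * \1_E x)%:C : R[i]).
Proof.
apply: cmeasurable_real; apply: measurable_funM; first exact: measurable_cst.
exact: measurable_indic.
Qed.

Lemma qform_indic A : measurable A ->
  qform mu (fun x => (\1_A x)%:E) (fun x => (c * \1_E x)%:C) =
  ((c ^+ 2)%:E * mu (A `&` E))%E.
Proof.
move=> mA; rewrite -[RHS]/((c ^+ 2)%:E * mu (A `&` E))%E.
have mAE : measurable (A `&` E) by exact: measurableI.
rewrite -(setIT (A `&` E)) -integral_indic// -ge0_integralZl_EFin ?sqr_ge0//; last first.
  by apply/measurable_EFinP/measurable_indic.
apply: eq_integral => x _; rewrite /sqmod /= expr0n /= addr0 -!EFinM; congr EFin.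
rewrite indicI /= exprMn !indicE; case: (x \in E) => /=.
  by rewrite expr1n !mulr1 mulrC.
by rewrite expr0n /= !mulr0.
Qed.

Lemma square_integrable_indic :
  square_integrable mu (fun x => (c * \1_E x)%:C).
Proof.
apply/(square_integrableE mu cmeasurable_indic).
have := qform_indic measurableT; rewrite setTI.
rewrite (_ : (fun x => _) = cst 1%E); last by apply/funext => x; rewrite indicT.
by move=> ->; rewrite lte_mul_pinfty// lee_fin sqr_ge0.
Qed.

Lemma indicL2E : \forall x \ae mu, indicL2 c E x = (c * \1_E x)%:C.
Proof. exact/L2ofE/square_integrable_indic. Qed.

Lemma qform_indicL2 A : measurable A ->
  qform mu (fun x => (\1_A x)%:E) (indicL2 c E) = ((c ^+ 2)%:E * mu (A `&` E))%E.
Proof.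
move=> mA; rewrite -qform_indic//.
have m1 : measurable_fun setT (fun x => (\1_A x)%:E : \bar R).
  exact/measurable_EFinP/measurable_indic.
apply: ae_eq_qform => //; first exact: L2_measurable.
  exact: cmeasurable_indic.
by apply: filterS indicL2E => x ->.
Qed.

End indicL2.

Lemma qform_setT F :
  qform mu (cst 1%E) F = qform mu (fun x => (\1_[set: X] x)%:E) F.
Proof. by congr qform; apply/funext => x; rewrite indicT. Qed.

Lemma qform_lt_of_dnorm F (e : R) : 0 < e -> dnorm dot F < Num.sqrt e ->
  (qform mu (cst 1%E) F < e%:E)%E.
Proof. by move=> e0; rewrite qform1 lte_fin /dnorm ltr_sqrt. Qed.

(** Functions with a finite form vanish where k is infinite, so the indicator of
    a set of positive finite measure on which k is infinite would be at distance
    at least its own norm from all of them. *)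
Lemma dense_weight_fin k : measurable_fun setT k -> (forall x, 0 <= k x)%E ->
  (forall F (e : R), 0 < e -> exists2 v : L2, (qform mu k v < +oo)%E &
     dnorm dot (F - v) < e) ->
  \forall x \ae mu, (k x < +oo)%E.
Proof.
move=> mk k0 kdense; pose A := k @^-1` [set +oo%E].
have mA : measurable A by rewrite -[A]setTI; exact: mk.
have [A0|A0] := eqVneq (mu A) 0%E.
  exists A; split => // x; rewrite /A /= => /negP.
  by rewrite -leNgt leye_eq => /eqP.
have [E [mE EA E0 Efin]] := exists_finite_positive_subset mA A0.
have Ef : mu E \is a fin_num by rewrite ge0_fin_numE ?measure_ge0.
pose e := Num.sqrt (fine (mu E)).
have e0 : 0 < e by rewrite sqrtr_gt0 fine_gt0// E0 Efin.
have [v kv] := kdense (indicL2 1 E) e e0.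
have mE0 : 0 < fine (mu E) by rewrite fine_gt0// E0 Efin.
move=> /(qform_lt_of_dnorm mE0); rewrite fineK// ltNge => /negP; case.
have v0 : \forall x \ae mu, E x -> v x = 0.
  have mkv := measurable_qform mk (L2_measurable v).
  have kvi : mu.-integrable setT (fun x => k x * (sqmod (v x))%:E)%E.
    apply/integrableP; split => //.
    by under eq_integral do rewrite gee0_abs ?mule_ge0 ?lee_fin ?sqmod_ge0//.
  apply: filterS (integrable_ae measurableT kvi) => x /(_ I) + /EA kx.
  rewrite kx; have [->//|v0] := eqVneq (v x) 0.
  rewrite gt0_mulye// lte_fin lt_neqAle sqmod_ge0 andbT eq_sym sqmod_eq0//.
have m1 : measurable_fun setT (fun x => (\1_E x)%:E : \bar R).
  exact/measurable_EFinP/measurable_indic.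
have <- : qform mu (fun x => (\1_E x)%:E) (indicL2 1 E) = mu E.
  by rewrite qform_indicL2// setIid expr1n mul1e.
have -> : qform mu (fun x => (\1_E x)%:E) (indicL2 1 E) =
    qform mu (fun x => (\1_E x)%:E) (indicL2 1 E - v : L2).
  apply: ae_eq_qform => //; do ?exact: L2_measurable.
  apply: filterS (filterI v0 (L2subE (indicL2 1 E) v)) => x [vx ->].
  rewrite indicE; have [xE|xE] := boolP (x \in E); last by rewrite !mul0e.
  by rewrite vx ?subr0//; move: xE; rewrite inE.
apply: le_qform => //.
- exact: L2_measurable.
- by apply: nearW => x; rewrite lee_fin indicE lern1 leq_b1.
Qed.

Lemma ae_le_Lnorm k : (forall x, 0 <= k x)%E ->
  \forall x \ae mu, (k x <= 'N[mu]_+oo[k])%E.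
Proof.
move=> k0; rewrite unlock; case: ifPn => [_|].
  by apply: filterS (ess_sup_ge mu (abse \o k)) => x /=; rewrite gee0_abs.
rewrite -leNgt => T0; exists setT; split => //.
by apply/eqP; rewrite eq_le T0 measure_ge0.
Qed.

Lemma Lnorm_le_ae k (c : R) : 0 <= c -> (forall x, 0 <= k x)%E ->
  (\forall x \ae mu, (k x <= c%:E)%E) -> ('N[mu]_+oo[k] <= c%:E)%E.
Proof.
move=> c0 k0 kc; rewrite unlock; case: ifPn => [_|_]; last by rewrite lee_fin.
by apply/ess_supP; apply: filterS kc => x /=; rewrite gee0_abs.
Qed.

(** The supremum is approached on normalized indicators of sets where k is close
    to its essential supremum; sigma-finiteness provides such sets of finite
    measure.  As the weight is bounded, T is everywhere defined. *)
Lemma op_norm_has_form (V : lmodType R[i]) (dV : {dot V for Num.conj})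
    (T : operator L2 V) k (M : R) :
  measurable_fun setT k -> (forall x, 0 <= k x)%E ->
  (\forall x \ae mu, (k x <= M%:E)%E) -> has_form dV T k ->
  op_norm dot dV T = ('N[mu]_+oo[k] `^ (2^-1)%R)%E.
Proof.
move=> mk k0 kM Tk; have [_ Td Tn] := Tk.
have kM' : \forall x \ae mu, (k x <= `|M|%:E)%E.
  by apply: filterS kM => x /le_trans; apply; rewrite lee_fin ler_norm.
have NM := Lnorm_le_ae (normr_ge0 M) k0 kM'.
have N0 := Lnorm_ge0 mu +oo k.
have kN := ae_le_Lnorm k0.
move: NM N0 kN; set N := ('N[mu]_+oo[k])%E => NM N0 kN.
have Nfin : N \is a fin_num by rewrite ge0_fin_numE// (le_lt_trans NM) ?ltry.
move: (fineK Nfin) kN N0; set c := fine N => <- kN; rewrite lee_fin => c0.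
rewrite poweR_EFin powR12_sqrt//.
have mc (b : R) : measurable_fun setT (cst b%:E : X -> \bar R).
  exact: measurable_cst.
have qc (b : R) F : 0 <= b -> qform mu (cst b%:E) F = (b * complex.Re (dot F F))%:E.
  move=> b0; rewrite EFinM -qform1 -qformZ//; last exact: L2_measurable.
  by congr qform; apply/funext => x /=; rewrite mule1.
have upper F v : T (F, v) -> (dnorm dot F <= 1) -> dnorm dV v <= Num.sqrt c.
  move=> TF F1; apply: ler_wsqrtr; rewrite -lee_fin (Tn _ _ TF).
  apply: (@le_trans _ _ (qform mu (cst c%:E) F)).
    by apply: le_qform => //; exact: L2_measurable.
  rewrite qc// lee_fin ler_piMr//.
  move: F1; rewrite /dnorm -[leRHS]sqrtr1 ler_sqrt//.
have Kdom F : dom T F.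
  apply/Td; apply: (@le_lt_trans _ _ (qform mu (cst c%:E) F)).
    by apply: le_qform => //; exact: L2_measurable.
  by rewrite qc// ltry.
apply/eqP; rewrite eq_le; apply/andP; split.
  apply: ge_ereal_sup => _ [[F v] /= [TF F1] <-]; rewrite lee_fin.
  exact: upper TF F1.
have sup0 : (0 <= op_norm dot dV T)%E.
  have T00 : T (0, 0) by have [] := has_form_linear mk Tk.
  apply: le_trans (_ : (dnorm dV 0)%:E <= _)%E; first by rewrite lee_fin sqrtr_ge0.
  apply: ereal_sup_ubound; exists (0, 0) => //; split => //=.
  by rewrite /dnorm linear0l sqrtr0.
rewrite leNgt; apply/negP => lt_sup.
have supfin : op_norm dot dV T \is a fin_num.
  by rewrite ge0_fin_numE// (lt_trans lt_sup) ?ltry.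
pose t := fine (op_norm dot dV T).
have tE : op_norm dot dV T = t%:E by rewrite fineK.
move: sup0 lt_sup; rewrite tE lee_fin lte_fin => t0 tc.
have t2c : t ^+ 2 < c.
  by rewrite -(sqr_sqrtr c0) ltr_pXn2r// ?nnegrE// ltW// (le_lt_trans t0).
pose b := (t ^+ 2 + c) / 2.
have /andP[tb bc] : t ^+ 2 < b < c by rewrite !midf_lt.
have b0 : 0 <= b by rewrite (le_trans (sqr_ge0 t)) ?ltW.
pose A := k @^-1` `]b%:E, +oo[.
have mA : measurable A by rewrite -[A]setTI; apply: mk => //; exact: emeasurable_itv.
have A0 : mu A != 0%E.
  apply/eqP => /(ae_le_measureP mu b%:E mk).2 => kb.
  have := Lnorm_le_ae b0 k0 kb; rewrite -/N -(fineK Nfin) -/c lee_fin.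
  by rewrite leNgt bc.
have [E [mE EA E0 Efin]] := exists_finite_positive_subset mA A0.
have Ef : mu E \is a fin_num by rewrite ge0_fin_numE ?measure_ge0.
pose m := fine (mu E).
have m0 : 0 < m by rewrite fine_gt0// E0 Efin.
have mEE : mu E = m%:E by rewrite fineK.
pose s := (Num.sqrt m)^-1.
have s2m : s ^+ 2 * m = 1.
  by rewrite exprVn sqr_sqrtr ?ltW// mulVf// gt_eqF.
pose F := indicL2 s E.
have q1 : qform mu (cst 1%E) F = 1%E.
  rewrite qform_setT qform_indicL2// setTI mEE -EFinM s2m//.
have F1 : complex.Re (dot F F) = 1 by move: q1; rewrite qform1 => -[].
have [v TF] := Kdom F.
have : (dnorm dV v <= t).
  rewrite -lee_fin -tE; apply: ereal_sup_ubound; exists (F, v) => //; split => //=.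
  by rewrite /dnorm F1 sqrtr1.
apply/negP; rewrite -ltNge /dnorm.
have m1 : measurable_fun setT (fun x => (\1_A x)%:E : \bar R).
  exact/measurable_EFinP/measurable_indic.
have qb : b <= complex.Re (dV v v).
  rewrite -lee_fin (Tn _ _ TF).
  have -> : b%:E = qform mu (fun x => b%:E * (\1_A x)%:E)%E F.
    rewrite qformZ//; last exact: L2_measurable.
    by rewrite qform_indicL2// (setIidr EA) mEE -!EFinM s2m mulr1.
  apply: le_qform => //.
  - exact: emeasurable_funM.
  - exact: L2_measurable.
  - by move=> x; rewrite mule_ge0// lee_fin.
  - apply: nearW => x; rewrite indicE; have [xA|_] := boolP (x \in A); last first.
      by rewrite mule0.
    by rewrite /= ?mulr1n mule1 ltW//; move: xA; rewrite inE /A /= in_itv /= andbT.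
have tRe : t ^+ 2 < complex.Re (dV v v) by exact: lt_le_trans qb.
rewrite -(ger0_norm t0) -sqrtr_sqr ltr_sqrt//.
exact: le_lt_trans (sqr_ge0 t) tRe.
Qed.

End sigma_finite.

(** * Polar factors *)

Section polar_decomposition.
Context d (X : measurableType d) (R : realType).
Variable mu : {measure set X -> \bar R}.
Local Notation L2 := (@L2 d X R mu).
Local Notation dot := (L2dot mu).
Implicit Types (F G : L2).
Variables (V : lmodType R[i]) (dV : {dot V for Num.conj}).

Lemma ker_has_form (T : operator L2 V) k F : has_form dV T k ->
  ker T F <-> qform mu k F = 0%E.
Proof.
move=> [_ Td Tn]; split=> [/Tn <-|q0]; first by rewrite linear0l.
have [v TF] : dom T F by apply/Td; rewrite q0 ltry.
suff v0 : v = 0 by move: TF; rewrite v0.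
by apply: (@Re_dot_eq0 _ _ dV); have := Tn _ _ TF; rewrite q0 => -[].
Qed.

Variable k : X -> \bar R.
Hypotheses (mk : measurable_fun setT k) (k0 : forall x, (0 <= k x)%E).
Hypothesis kfin : \forall x \ae mu, (k x < +oo)%E.

(** The weight of the polar factor of an operator of weight k. *)
Definition support_weight x : \bar R := (\1_[set y | (0 < k y)%E] x)%:E.

Lemma measurable_support : measurable [set y | (0 < k y)%E].
Proof.
rewrite (_ : [set y | _] = k @^-1` `]0%E, +oo[).
  by rewrite -[X in measurable X]setTI; apply: mk => //; exact: emeasurable_itv.
by apply/seteqP; split => x /=; rewrite in_itv /= andbT.
Qed.

Lemma measurable_support_weight : measurable_fun setT support_weight.
Proof. exact/measurable_EFinP/measurable_indic/measurable_support. Qed.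

Lemma support_weight_ge0 x : (0 <= support_weight x)%E.
Proof. by rewrite lee_fin. Qed.

Lemma support_weight_le1 x : (support_weight x <= 1)%E.
Proof. by rewrite lee_fin indicE lern1 leq_b1. Qed.

Lemma qform_eq0 k' F : measurable_fun setT k' -> (forall x, 0 <= k' x)%E ->
  qform mu k' F = 0%E <-> \forall x \ae mu, (0 < k' x)%E -> F x = 0.
Proof.
move=> mk' k'0; have mq := measurable_qform mk' (L2_measurable F).
have -> : (qform mu k' F = 0%E) <->
    (\int[mu]_x `|k' x * (sqmod (F x))%:E| = 0)%E.
  by rewrite /qform; under [in X in _ <-> X]eq_integral do
    rewrite gee0_abs ?mule_ge0 ?lee_fin ?sqmod_ge0//.
rewrite (ae_eq_integral_abs mu measurableT mq); split; apply: filterS => x.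
- move=> /(_ I) /eqP; rewrite mule_eq0 => /orP[/eqP ->|]; first by rewrite ltxx.
  by rewrite eqe sqmod_eq0 => /eqP.
- move=> h _; have := k'0 x; rewrite le_eqVlt => /orP[/eqP <-|/h ->].
    by rewrite mul0e.
  have -> : sqmod (0 : R[i]) = 0 by apply/eqP; rewrite sqmod_eq0.
  by rewrite mule0.
Qed.

Lemma qform_support_eq0 F :
  qform mu support_weight F = 0%E <-> qform mu k F = 0%E.
Proof.
rewrite (qform_eq0 _ measurable_support_weight support_weight_ge0).
rewrite (qform_eq0 _ mk k0).
by split; apply: filterS => x h kx; apply: h; move: kx;
  rewrite /support_weight lte_fin indicE ltr0n lt0b inE.
Qed.

Section factor.
Variables (T W : operator L2 V).
Hypotheses (Tk : has_form dV T k) (Wk : has_form dV W support_weight).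
Hypothesis TW : T = comp_op W (mul_op mu (csqrt k)).

Lemma ker_eq : ker W = ker T.
Proof.
apply/seteqP; split => F; rewrite (ker_has_form _ Tk) (ker_has_form _ Wk).
  by rewrite qform_support_eq0.
by rewrite qform_support_eq0.
Qed.

Lemma ker_factorE F : ker W F <-> \forall x \ae mu, (0 < k x)%E -> F x = 0.
Proof.
by rewrite (ker_has_form _ Wk) qform_support_eq0 qform_eq0.
Qed.

Lemma qform_support_le F : (qform mu support_weight F <= qform mu (cst 1%E) F)%E.
Proof.
apply: le_qform => //.
- exact: measurable_support_weight.
- exact: L2_measurable.
- exact: support_weight_ge0.
- by apply: nearW => x; exact: support_weight_le1.
Qed.

Lemma dom_factor F : dom W F.
Proof.
have [_ Wd _] := Wk; apply/Wd; apply: le_lt_trans (qform_support_le F) _.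
by rewrite qform1 ltry.
Qed.

Let off_support : measurable (~` [set y | (0 < k y)%E]).
Proof. exact/measurableC/measurable_support. Qed.

Lemma ker_off_support F : ker W (mulL2 \1_(~` [set y | (0 < k y)%E]) F).
Proof.
apply/ker_factorE.
apply: filterS (bounded_mulL2E F (bounded_mult_indic R off_support)) => x -> kx.
by rewrite indicE memNset ?mul0r//; apply.
Qed.

(** A function orthogonal to the kernel vanishes off the support of k, where its
    restriction belongs to the kernel. *)
Lemma partial_isometry_has_form : partial_isometry dot dV W.
Proof.
have [_ _ Wn] := Wk; split.
- exact: has_form_linear measurable_support_weight Wk.
- by apply/seteqP; split => // F _; exact: dom_factor.
- apply: (@le_lt_trans _ _ 1%E); last by rewrite ltry.
  apply: ge_ereal_sup => _ [[F v] /= [WF F1] <-].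
  rewrite lee_fin (le_trans _ F1)// /dnorm ler_wsqrtr// -lee_fin (Wn _ _ WF).
  by rewrite -qform1; exact: qform_support_le.
- move=> F v WF orth; rewrite /dnorm; congr (Num.sqrt _).
  apply: EFin_inj; rewrite (Wn _ _ WF) -qform1.
  set N := ~` [set y | (0 < k y)%E]; pose n := mulL2 \1_N F.
  have bN := bounded_mult_indic R off_support.
  have n0 : n = 0.
    apply: (@Re_dot_eq0 _ _ dot).
    suff nn : dot n n = 0 by exact: (congr1 (@complex.Re R) nn).
    rewrite -(orth n (ker_off_support F)); apply: eq_L2dot.
    apply: filterS (bounded_mulL2E F bN) => x ->.
    rewrite indicE; case: (x \in N) => /=; first by rewrite mul1r.
    by rewrite mul0r conjc0 mulr0 mulr0.
  have h : \forall x \ae mu, n x = 0 by rewrite n0; exact: L20E.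
  apply: ae_eq_qform; [exact: measurable_support_weight|exact: measurable_cst
    |exact: L2_measurable|exact: L2_measurable|].
  apply: filterS (filterI (bounded_mulL2E F bN) h) => x [e1 e2].
  have [kx|kx] := boolP (0 < k x)%E; first by rewrite /support_weight indicE mem_set.
  move: e1; rewrite -/n e2 indicE mem_set ?mul1r => [<-|]; last exact/negP.
  have -> : sqmod (0 : R[i]) = 0 by apply/eqP; rewrite sqmod_eq0.
  by rewrite !mule0.
Qed.

(** W' and W agree on the kernel of T and on the range of multiplication by
    sqrt k.  The truncations of F to the set where k = 0 or sqrt k >= 1 / (n + 1)
    are sums of such functions and converge to F, and the remainders are
    orthogonal to the kernel, hence mapped isometrically by both W' and W. *)
Lemma polar_factor_unique (W' : operator L2 V) : partial_isometry dot dV W' ->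
  ker W' = ker T -> T = comp_op W' (mul_op mu (csqrt k)) -> W' = W.
Proof.
set M := mul_op mu (csqrt k) => -[[W'0 W'lin W'fun] W'dom _ W'iso] kerW' TW'.
have Mk : has_form dot M k := has_form_mul_op mk k0 kfin.
have [Wlin _ Wn] := Wk; have Wfun := fun F v w => @has_form_functional _ _ _ _ _ _ W _ F v w Wk.
have [_ _ _ Wiso] := partial_isometry_has_form.
have subW' F G v w : W' (F, v) -> W' (G, w) -> W' (F - G, v - w).
  by apply: graph_sub W'lin.
have addW (S : operator L2 V) F G v w :
    (forall (a : R[i]) p q, S p -> S q -> S (a *: p + q)) ->
    S (F, v) -> S (G, w) -> S (F + G, v + w).
  move=> lin WF WG; have := lin 1 _ _ WF WG; rewrite scale1r; exact.
have agree F v v' : W (F, v) -> W' (F, v') -> v' = v.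
  move=> WF W'F; apply/eqP; rewrite -subr_eq0; apply/eqP/(@Re_dot_eq0 _ _ dV).
  set D := v' - v; apply/eqP; rewrite eq_le Re_dot_ge0 andbT.
  pose g x := Num.sqrt (fine (k x)).
  have mg : measurable_fun setT g := measurable_sqrt_fine mk.
  have g0 x : 0 <= g x by rewrite sqrtr_ge0.
  pose P n := g @^-1` `[n.+1%:R^-1, +oo[.
  have mP n : measurable (P n) by rewrite -[P n]setTI; exact: mg.
  pose N := ~` [set y | (0 < k y)%E].
  pose E n := N `|` P n.
  have mE n : measurable (E n) by exact: measurableU.
  have hE : \forall x \ae mu, F x != 0 -> \forall n \near \oo, E n x.
    apply: filterS kfin => x kx _; have [kx0|kx0] := ltP 0%E (k x); last first.
      by apply: nearW => n; left => /=; apply/negP; rewrite -leNgt.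
    have gx : 0 < g x by rewrite sqrtr_gt0 fine_gt0// kx0 kx.
    exists (Num.bound (g x)^-1) => // n /= hn; right; rewrite /P /= in_itv /= andbT.
    rewrite invf_ple ?posrE ?ltr0n//; apply: ltW.
    apply: lt_le_trans (archi_boundP _) _; first by rewrite invr_ge0.
    by rewrite ler_nat (leq_trans hn).
  apply/ler_addgt0Pr => e e0; rewrite add0r.
  have e4 : 0 < Num.sqrt (e / 4) by rewrite sqrtr_gt0 divr_gt0.
  have [n hn] := L2_truncation mE hE e4.
  set Fn := mulL2 \1_(E n) F in hn.
  have bE := bounded_mult_indic R (mE n).
  have bN := bounded_mult_indic R off_support.
  pose A := mulL2 \1_N F; pose Q := P n `&` [set y | (0 < k y)%E].
  have mQ : measurable Q by apply: measurableI => //; exact: measurable_support.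
  have bQ := bounded_mult_indic R mQ.
  pose B := mulL2 \1_Q F.
  have FnE : Fn = A + B.
    apply/L2P; apply: filterS (filterI (bounded_mulL2E F bE) (filterI
      (bounded_mulL2E F bN) (filterI (bounded_mulL2E F bQ) (L2addE A B)))).
    move=> x [-> [e1 [e2 ->]]]; rewrite e1 e2 -mulrDl -rmorphD; congr (_%:C * _).
    rewrite /E /Q /N !indicE !(in_setU, in_setI, in_setC).
    by case: (x \in P n); case: (x \in [set y | _]) => /=; rewrite ?addr0 ?add0r.
  have WA : W (A, 0) := ker_off_support F.
  have W'A : W' (A, 0).
    have : ker W' A by rewrite kerW' -ker_eq; exact: ker_off_support.
    exact.
  pose q x := (g x)^-1 * \1_Q x.
  have bq : bounded_mult q.
    split.
      by apply: measurable_funM; [exact: measurable_funV|exact: measurable_indic].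
    exists n.+1%:R => x; rewrite /q indicE; have [xQ|_] := boolP (x \in Q); last first.
      by rewrite mulr0 normr0.
    rewrite mulr1 ger0_norm ?invr_ge0//; move: xQ; rewrite inE => -[].
    rewrite /P /= in_itv /= andbT => h1 _.
    by rewrite -[leRHS]invrK lef_pV2// ?posrE ?invr_gt0 ?ltr0n//
      (lt_le_trans _ h1)// invr_gt0 ltr0n.
  have MB : M (mulL2 q F, B).
    apply: filterS (filterI (bounded_mulL2E F bq) (bounded_mulL2E F bQ)).
    move=> x /= [-> ->]; rewrite mulrA -rmorphM /q; congr (_%:C * _).
    rewrite indicE; have [xQ|_] := boolP (x \in Q); last by rewrite !mulr0.
    rewrite !mulr1 divff// gt_eqF//; move: xQ; rewrite inE => -[].
    rewrite /P /= in_itv /= andbT => h1 _.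
    by rewrite (lt_le_trans _ h1)// invr_gt0 ltr0n.
  have [t WB] := dom_factor B.
  have : T (mulL2 q F, t) by rewrite TW; exists B.
  rewrite TW' => -[B' /= [MB' W'B']].
  have BB : B' = B := has_form_functional Mk MB' MB; rewrite {}BB in W'B'.
  have WFn : W (Fn, t) by rewrite FnE -[t]add0r; exact: addW.
  have W'Fn : W' (Fn, t) by rewrite FnE -[t]add0r; exact: addW.
  have orth : forall G, ker W G -> dot (F - Fn) G = 0.
    move=> G /ker_factorE G0; rewrite -[RHS](linear0l dot G); apply: eq_L2dot.
    apply: filterS (filterI G0 (filterI (L2subE F Fn) (filterI (L20E mu)
      (bounded_mulL2E F bE)))) => x [Gx [-> [-> ->]]].
    rewrite mul0r; have [kx|kx] := ltP 0%E (k x).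
      by rewrite Gx// conjc0 mulr0.
    rewrite indicE mem_set ?mul1r ?subrr ?mul0r//; left => /=.
    by apply/negP; rewrite -leNgt.
  have nW := Wiso _ _ (has_form_sub Wk WF WFn) orth.
  have nW' : dnorm dV (v' - t) = dnorm dot (F - Fn).
    by apply: W'iso (subW' _ _ _ _ W'F W'Fn) _ => G; rewrite kerW' -ker_eq; exact: orth.
  have toRe (z : V) : dnorm dV z = dnorm dot (F - Fn) ->
      complex.Re (dV z z) <= e / 4.
    move=> hz; have : dnorm dV z < Num.sqrt (e / 4) by rewrite hz.
    by rewrite /dnorm ltr_sqrt ?divr_gt0// => /ltW.
  have r1 := toRe _ nW; have r2 := toRe _ nW'.
  have -> : D = (v' - t) - (v - t) by rewrite /D opprB addrA subrK.
  set y := v' - t in r2 *; set z := v - t in r1 *.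
  have s1 := Re_dot_add dV y (- z); have s2 := Re_dot_add dV y z.
  have s3 : complex.Re (dV y (- z)) = - complex.Re (dV y z).
    by rewrite linearNr /=; case: (dV y z).
  have s4 : complex.Re (dV (- z) (- z)) = complex.Re (dV z z).
    by rewrite linearNr linearNl opprK.
  have := Re_dot_ge0 dV (y + z); lra.
apply/seteqP; split => -[F v].
- by move=> W'F; have [w WF] := dom_factor F; rewrite (agree _ _ _ WF W'F).
- move=> WF; have [w W'F] : dom W' F by rewrite W'dom.
  by rewrite -(agree _ _ _ WF W'F).
Qed.

Lemma polar_factor_has_form : polar_factor dot dV T = W.
Proof.
have absT : abs_op dot dV T = mul_op mu (csqrt k) := abs_op_has_form mk k0 kfin Tk.
apply: xget_unique; rewrite absT.
  by split; [exact: partial_isometry_has_form|exact: ker_eq|].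
by move=> W' [pi kerW' TW']; exact: polar_factor_unique.
Qed.

End factor.
End polar_decomposition.

(** * Columns of weighted composition operators *)

Section joint_polar.
Context d (X : measurableType d) (R : realType).
Variable mu : {sigma_finite_measure set X -> \bar R}.
Local Notation L2 := (@L2 d X R mu).
Local Notation dot := (L2dot mu).

Lemma wco_density_mul phi omega omega' h (u : X -> R) :
  wco_symbol mu phi omega -> wco_density mu phi omega h ->
  measurable_fun setT u -> cmeasurable omega' ->
  (\forall x \ae mu, sqmod (omega' x) = u (phi x) ^+ 2 * sqmod (omega x)) ->
  wco_density mu phi omega' (fun x => (u x ^+ 2)%:E * h x)%E.
Proof.
move=> sym den mu_ mom' om'E; have [mphi mom _] := sym; have [mh h0 _] := den.
have mu2 : measurable_fun setT (fun x => (u x ^+ 2)%:E).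
  by apply/measurable_EFinP; exact: measurable_funX.
split.
- exact: emeasurable_funM.
- by move=> x; rewrite mule_ge0// lee_fin sqr_ge0.
- move=> A mA; have mphiA : measurable (phi @^-1` A).
    by rewrite -[_ @^-1` _]setTI; exact: mphi.
  have mi (B : set X) : measurable B -> measurable_fun setT (fun x => (\1_B x)%:E : \bar R).
    by move=> mB; exact/measurable_EFinP/measurable_indic.
  have mk : measurable_fun setT (fun x => (\1_A x)%:E * (u x ^+ 2)%:E)%E.
    by apply: emeasurable_funM => //; exact: mi.
  rewrite /image_wmeasure /wmeasure integral_mkcond [RHS]integral_mkcond.
  transitivity (\int[mu]_x (((\1_A (phi x))%:E * (u (phi x) ^+ 2)%:E) *
      (sqmod (omega x))%:E))%E.
    apply: ae_eq_integral => //.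
    + apply/(measurable_restrictT _ mphiA).
      exact/measurable_funTS/measurable_sqmod.
    + apply: emeasurable_funM; last exact: measurable_sqmod.
      exact: measurableT_comp mk mphi.
    + apply: filterS om'E => x om'x _; rewrite patchE indicE om'x.
      have -> : (phi x \in A) = (x \in phi @^-1` A) by apply/idP/idP; rewrite !inE.
      by case: ifP => _; rewrite ?mul0e// mul1e.
  rewrite (wco_density_integral sym den mk); last first.
    by move=> x; rewrite mule_ge0// lee_fin ?sqr_ge0.
  apply: eq_integral => x _; rewrite patchE indicE.
  by case: ifP => _; rewrite ?mul0e// mul1e.
Qed.

Lemma wco_density_symbol phi omega h : measurable_fun setT phi ->
  cmeasurable omega -> wco_density mu phi omega h -> wco_symbol mu phi omega.
Proof.
move=> mphi mom [mh _ hE]; split => //; apply/null_content_dominatesP => A mA A0.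
by rewrite hE// null_set_integral//; exact: measurable_funTS.
Qed.

Lemma ae_eq_wco phi omega omega' : (\forall x \ae mu, omega x = omega' x) ->
  wco mu phi omega = wco mu phi omega'.
Proof.
move=> e; apply/seteqP; split => p h; apply: filterS (filterI e h) => x [].
- by move=> e1 /= ->; rewrite e1.
- by move=> e1 /= ->; rewrite e1.
Qed.

(** The integral of |omega|^2 over the preimage under phi of the zeros of h is the
    integral of h over its own zeros. *)
Lemma wco_density_neq0 phi omega h :
  wco_symbol mu phi omega -> wco_density mu phi omega h ->
  \forall x \ae mu, omega x != 0 -> (0 < h (phi x))%E.
Proof.
move=> sym den; have [mphi mom _] := sym; have [mh h0 hE] := den.
pose A := h @^-1` [set 0%E].
have mA : measurable A by rewrite -[A]setTI; exact: mh.
have mphiA : measurable (phi @^-1` A) by rewrite -[_ @^-1` _]setTI; exact: mphi.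
have : (\int[mu]_(x in phi @^-1` A) `|(sqmod (omega x))%:E| = 0)%E.
  transitivity (image_wmeasure mu phi omega A).
    by apply: eq_integral => x _; rewrite gee0_abs// lee_fin sqmod_ge0.
  by rewrite hE//; apply: integral0_eq => x.
have mw := measurable_funTS (measurable_sqmod mom).
move=> /(ae_eq_integral_abs mu mphiA (mw _)).1.
apply: filterS => x h1 om0; rewrite lt_neqAle h0 andbT; apply/eqP => hx.
by have /h1[/eqP] : (phi @^-1` A) x by []; rewrite sqmod_eq0 (negbTE om0).
Qed.

Variables (I : finType) (phi : I -> X -> X) (omega : I -> X -> R[i])
  (h : I -> X -> \bar R).
Hypothesis sym : forall i, wco_symbol mu (phi i) (omega i).
Hypothesis den : forall i, wco_density mu (phi i) (omega i) (h i).
Hypothesis dense : forall i, densely_defined dot (wco mu (phi i) (omega i)).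

Let C i := wco mu (phi i) (omega i).
Let hh x := (\sum_i h i x)%E.

Let mh i : measurable_fun setT (h i). Proof. by case: (den i). Qed.
Let h0 i x : (0 <= h i x)%E. Proof. by case: (den i) => _ /(_ x). Qed.

Lemma wco_density_fin i : \forall x \ae mu, (h i x < +oo)%E.
Proof.
have [_ Cd _] := has_form_wco (sym i) (den i).
apply: dense_weight_fin => // F e e0; have [v /Cd kv Fv] := dense i F e0.
by exists v.
Qed.

Let mhh : measurable_fun setT hh.
Proof. exact: emeasurable_sum. Qed.

Let hh0 x : (0 <= hh x)%E. Proof. exact: sume_ge0. Qed.

Lemma ae_forall_fin (P : I -> X -> Prop) :
  (forall i, \forall x \ae mu, P i x) -> \forall x \ae mu, forall i, P i x.
Proof. by move=> hP; exact: filter_forall. Qed.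

Lemma hh_fin : \forall x \ae mu, (hh x < +oo)%E.
Proof.
apply: filterS (ae_forall_fin wco_density_fin) => x hx.
exact: lte_sum_pinfty.
Qed.

Lemma le_hh i x : (h i x <= hh x)%E.
Proof. by rewrite /hh (bigD1 i)//= leeDl// sume_ge0. Qed.

Lemma has_form_joint : has_form (sumdot dot) (column_op C) hh.
Proof. by apply: has_form_column => // i; exact: has_form_wco. Qed.

Let u x := (Num.sqrt (fine (hh x)))^-1.

Let mu_u : measurable_fun setT u.
Proof.
by apply: measurable_funV; [exact: measurable_sqrt_fine|move=> x; exact: sqrtr_ge0].
Qed.

Definition polar_weight i x : R[i] :=
  if omega i x == 0 then 0 else omega i x / csqrt hh (phi i x).

(** Almost everywhere the quotient of h_i by hh, extended by 0 off the support of
    hh; this form is an exact density for the weight above. *)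
Definition polar_density i x : \bar R := ((u x ^+ 2)%:E * h i x)%E.

Lemma polar_weightE i x : polar_weight i x = (u (phi i x))%:C * omega i x.
Proof.
rewrite /polar_weight; case: eqP => [->|_]; first by rewrite mulr0.
by rewrite mulrC /csqrt /u fmorphV.
Qed.

Lemma cmeasurable_polar_weight i : cmeasurable (polar_weight i).
Proof.
have [mphi mom _] := sym i.
rewrite (_ : polar_weight i = fun x => (u (phi i x))%:C * omega i x); last first.
  by apply/funext => x; exact: polar_weightE.
apply: cmeasurableM => //; apply: cmeasurable_real.
exact: measurableT_comp mu_u mphi.
Qed.

Lemma wco_density_polar i (w : X -> R[i]) : cmeasurable w ->
  (\forall x \ae mu, w x = polar_weight i x) ->
  wco_density mu (phi i) w (polar_density i).
Proof.
move=> mw wE; apply: (wco_density_mul (sym i) (den i)) => //.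
by apply: filterS wE => x ->; rewrite polar_weightE sqmodR.
Qed.

Lemma wco_symbol_polar i (w : X -> R[i]) : cmeasurable w ->
  (\forall x \ae mu, w x = polar_weight i x) -> wco_symbol mu (phi i) w.
Proof.
move=> mw wE; have [mphi _ _] := sym i.
exact: wco_density_symbol mphi mw (wco_density_polar mw wE).
Qed.

Let sym' i : wco_symbol mu (phi i) (polar_weight i).
Proof. by apply: wco_symbol_polar; [exact: cmeasurable_polar_weight|exact: aeW]. Qed.

Let den' i : wco_density mu (phi i) (polar_weight i) (polar_density i).
Proof. by apply: wco_density_polar; [exact: cmeasurable_polar_weight|exact: aeW]. Qed.

Let W i := wco mu (phi i) (polar_weight i).

Lemma sqr_uE x : (0 < hh x)%E -> (hh x < +oo)%E -> (u x ^+ 2)%:E = (hh x)^-1%E.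
Proof.
move=> hx0 hx; have hf : hh x \is a fin_num by rewrite ge0_fin_numE.
rewrite -[in RHS](fineK hf) inver /u exprVn sqr_sqrtr ?fine_ge0//.
by rewrite gt_eqF// fine_gt0// hx0 hx.
Qed.

Lemma polar_density_ratio i : \forall x \ae mu, polar_density i x =
  (h i x / hh x * (\1_[set y | (0 < hh y)%E] x)%:E)%E.
Proof.
apply: filterS hh_fin => x hx; rewrite /polar_density indicE.
have [hx0|hx0] := boolP (0 < hh x)%E.
  by rewrite mem_set// mule1 muleC sqr_uE.
rewrite memNset; last exact/negP.
rewrite mule0; suff -> : h i x = 0%E by rewrite mule0.
apply/eqP; rewrite eq_le h0 andbT; apply: le_trans (le_hh i x) _.
by rewrite leNgt.
Qed.

Lemma polar_density_sum : \forall x \ae mu,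
  (\sum_i polar_density i x)%E = support_weight hh x.
Proof.
apply: filterS hh_fin => x hx.
rewrite /polar_density -ge0_sume_distrr// -/(hh x) /support_weight indicE.
have [hx0|hx0] := boolP (0 < hh x)%E.
  rewrite mem_set// sqr_uE// muleC divee ?gt_eqF//.
  by rewrite ge0_fin_numE.
rewrite memNset; last exact/negP.
suff -> : hh x = 0%E by rewrite mule0.
by apply/eqP; rewrite eq_le hh0 andbT leNgt.
Qed.

Let mden i : measurable_fun setT (polar_density i).
Proof. by case: (den' i). Qed.

Let den0 i x : (0 <= polar_density i x)%E.
Proof. by case: (den' i) => _ /(_ x). Qed.

Lemma has_form_polar : has_form (sumdot dot) (column_op W) (support_weight hh).
Proof.
apply: (ae_eq_has_form _ _ polar_density_sum).
- exact: emeasurable_sum.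
- exact: measurable_support_weight.
- by apply: has_form_column => // i; exact: has_form_wco.
Qed.

Lemma csqrt_hh_neq0 i : \forall x \ae mu, omega i x != 0 ->
  csqrt hh (phi i x) != 0.
Proof.
have h1 := wco_density_neq0 (sym i) (den i).
have h2 := wco_symbol_ae (sym i) hh_fin.
apply: filterS (filterI h1 h2) => x [hx1 hx2] om0.
rewrite /csqrt fmorph_eq0 gt_eqF// sqrtr_gt0 fine_gt0//.
by rewrite hx2// andbT (lt_le_trans (hx1 om0) (le_hh _ _)).
Qed.

Lemma wco_polarE i (F G v : L2) : mul_op mu (csqrt hh) (F, G) ->
  C i (F, v) <-> W i (G, v).
Proof.
move=> FG; have h1 : \forall x \ae mu, omega i x != 0 ->
    G (phi i x) = csqrt hh (phi i x) * F (phi i x).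
  exact: wco_symbol_ae (sym i) FG.
have h2 := csqrt_hh_neq0 i.
have e : \forall x \ae mu, omega i x * F (phi i x) = polar_weight i x * G (phi i x).
  apply: filterS (filterI h1 h2) => x [Gx sx]; rewrite /polar_weight.
  case: eqP => [->|/eqP om0]; first by rewrite !mul0r.
  by rewrite Gx// mulrA divfK// sx.
split => hv; apply: filterS (filterI e hv) => x [ex /= ->].
  by rewrite ex.
by rewrite ex.
Qed.

(** Multiplying by sqrt hh and composing with phi_i cancels the denominator of the
    polar weight, which vanishes almost nowhere on the support of omega_i; both
    sides have the domain of the operators of weight hh. *)
Lemma column_polarE : column_op C = comp_op (column_op W) (mul_op mu (csqrt hh)).
Proof.
have [_ Cd _] := has_form_joint.
have [_ Md _] := has_form_mul_op mhh hh0 hh_fin.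
apply/seteqP; split => -[F v] /=.
- move=> CF; have [G FG] := (Md F).2 ((Cd F).1 (ex_intro _ v CF)).
  by exists G; split => // i /=; apply/(wco_polarE _ _ FG); exact: CF.
- by move=> [G [FG WG]] i /=; apply/(wco_polarE _ _ FG); exact: WG.
Qed.

Lemma abs_op_joint :
  abs_op dot (sumdot dot) (column_op C) = mul_op mu (csqrt hh).
Proof. exact: (@abs_op_has_form _ _ _ _ _ mhh hh0 hh_fin _ _ _ has_form_joint). Qed.

Lemma polar_factor_joint :
  polar_factor dot (sumdot dot) (column_op C) = column_op W.
Proof.
exact: (@polar_factor_has_form _ _ _ _ _ _ _ mhh hh0 hh_fin _ _
  has_form_joint has_form_polar column_polarE).
Qed.

Lemma polar_density_le1 i : \forall x \ae mu, (polar_density i x <= 1%:E)%E.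
Proof.
apply: filterS polar_density_sum => x ex; apply: le_trans (support_weight_le1 hh x).
by rewrite -ex (bigD1 i)//= leeDl// sume_ge0.
Qed.

Lemma dom_polar i F : dom (W i) F.
Proof.
have [_ Wd _] := has_form_wco (sym' i) (den' i); apply/Wd.
apply: (@le_lt_trans _ _ (qform mu (cst 1%E) F)); last by rewrite qform1 ltry.
apply: le_qform => //; [exact: L2_measurable|exact: polar_density_le1].
Qed.

Lemma entry_polar i : entry_op (column_op W) i = W i.
Proof.
apply/seteqP; split => -[F v] /=.
  by move=> [w [/(_ i) /= WF /= wi]]; rewrite -wi.
move=> WF; have [w hw] := choice (fun j => dom_polar j F).
exists [ffun j => if j == i then v else w j]; split => [j|] /=; rewrite ffunE ?eqxx//.
by have [->//|ji] := eqVneq j i; exact: hw.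
Qed.

Lemma op_norm_polar i : op_norm dot dot (W i) =
  ('N[mu]_+oo[(fun x => h i x / hh x * (\1_[set y | (0 < hh y)%E] x)%R%:E)] `^ (2^-1)%R)%E.
Proof.
rewrite (op_norm_has_form (mden i) (den0 i) (polar_density_le1 i)
  (has_form_wco (sym' i) (den' i))).
congr (_ `^ _)%E; rewrite unlock; case: ifP => // _; apply: eq_ess_sup.
by apply: filterS (polar_density_ratio i) => x /= ->.
Qed.

End joint_polar.

Theorem theorem8 (d : measure_display) (X : measurableType d) (R : realType)
    (mu : {sigma_finite_measure set X -> \bar R})
    (phi : 'I_2 -> X -> X) (omega : 'I_2 -> X -> R[i])
    (h : 'I_2 -> X -> \bar R) :
  (forall i, wco_symbol mu (phi i) (omega i)) ->
  (forall i, wco_density mu (phi i) (omega i) (h i)) ->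
  (forall i, densely_defined (L2dot mu) (wco mu (phi i) (omega i))) ->
  let C := fun i => wco mu (phi i) (omega i) in
  let CC := column_op C in
  let hh := fun x => (h ord0 x + h ord_max x)%E in
  let U := polar_factor (L2dot mu) (sumdot (L2dot mu)) CC in
  [/\ abs_op (L2dot mu) (sumdot (L2dot mu)) CC = mul_op mu (csqrt hh),
      (forall i : 'I_2,
        abs_op (L2dot mu) (L2dot mu) (C i) =
          abs_op (L2dot mu) (sumdot (L2dot mu))
            (column_op (pair_op (C i) (zero_op (L2 mu) (L2 mu)))) /\
        abs_op (L2dot mu) (L2dot mu) (C i) = mul_op mu (csqrt (h i))),
      (forall (i : 'I_2) (womega : X -> R[i]), cmeasurable womega ->
        (\forall x \ae mu, womega x =
          if omega i x == 0 then 0 else omega i x / csqrt hh (phi i x)) ->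
        wco_symbol mu (phi i) womega /\
        entry_op U i = wco mu (phi i) womega)
    & forall i : 'I_2,
        let ratio := fun x =>
          (h i x / hh x * (\1_[set y | (0 < hh y)%E] x)%R%:E)%E in
        op_norm (L2dot mu) (L2dot mu) (entry_op U i) =
        ('N[mu]_+oo[ratio] `^ (2^-1)%R)%E].
Proof.
move=> sym den dense C CC hh U.
have hhE : hh = fun x => (\sum_i h i x)%E.
  apply/funext => x; rewrite big_ord_recl big_ord1; congr (_ + h _ _)%E.
  exact: val_inj.
have mh i : measurable_fun setT (h i) by case: (den i).
have h0 i x : (0 <= h i x)%E by case: (den i) => _ /(_ x).
have hfin := wco_density_fin sym den dense.
rewrite /U /CC (polar_factor_joint sym den dense) hhE.
split.
- exact: abs_op_joint.
- move=> i; have Ci := has_form_wco (sym i) (den i).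
  have absC := abs_op_has_form (mh i) (h0 i) (hfin i) Ci.
  rewrite absC; split => //; apply/esym.
  apply: (abs_op_has_form (mh i) (h0 i) (hfin i)).
  pose k (j : 'I_2) : X -> \bar R := if j == ord0 then h i else cst 0%E.
  have -> : h i = fun x => (\sum_j k j x)%E.
    by apply/funext => x; rewrite big_ord_recl big_ord1 /k /= adde0.
  apply: has_form_column => j; rewrite /k /pair_op; case: eqP => // _.
  exact: has_form_zero_op.
- move=> i w mw wE; split; first exact: wco_symbol_polar mw wE.
  by rewrite entry_polar//; apply: ae_eq_wco; apply: filterS wE => x ->.
- by move=> i /=; rewrite entry_polar// op_norm_polar.
Qed.
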